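(* Let $G$ be a step $s$ Carnot group, $E \subset G$ a subset, $B_G(x,r)$ a ball in $G$, and $\rho$ a left-invariant Riemannian metric (distance) on $G$. The following quantities are equivalent up to multiplicative constants depending only on $d$, $\rho$, and the Euclidean structure $|\cdot|$: (1) $\hat{\beta}_E(x,r)$, (2) $\inf_L \inf \{ \epsilon > 0 : E \cap B_G(x,r) \subset L \cdot \delta_r(B_{\mathbb{R}^n}(\epsilon^s)) \}$, (3) $\inf_L \sup \{ \rho(z,L)^{1/s} : z \in \delta_{1/r}(x^{-1}E) \cap B_G(0,1) \}$. Here, the $L$ in the infimums of (2) and (3) vary over horizontal lines.
   Context: A Carnot group of step $s$ is a simply connected Lie group $G$ whose Lie algebra has a stratification $\mathfrak g = V_1\oplus\cdots\oplus V_s$ with $[V_1,V_j]=V_{j+1}$ for $j\ge 1$ (with $V_k=0$ for $k>s$ and $V_s\ne 0$). Via $\exp$ and a choice of bases of the $V_i$, $G$ is identified with $\mathbb R^n=\mathbb R^{n_1+\cdots+n_s}$, $n_i=\dim V_i$ (exponential coordinates $g=(g_1,\dots,g_s)$, identity $0$); $|\cdot|$ is the Euclidean norm on $\mathbb R^n$ (up to a fixed scalar multiple) coming from this choice of bases and $B_{\mathbb R^n}(\epsilon)=\{g\in G:|g|<\epsilon\}$. The dilations $\delta_\lambda(g_1,\dots,g_s)=(\lambda g_1,\lambda^2 g_2,\dots,\lambda^s g_s)$, $\lambda>0$, are automorphisms. For $1\le i\le s$, $\pi_i:G\to G/\exp(V_{i+1}\oplus\cdots\oplus V_s)$ is the quotient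 homomorphism, in coordinates $\pi_i(g)=(g_1,\dots,g_i)$; $\pi_i(G)$ is again a Carnot group. A homogeneous norm is a function $N:G\to[0,\infty)$ with $N(g^{-1})=N(g)$, $N(\delta_\lambda(g))=\lambda N(g)$, $N(g)=0\Leftrightarrow g=0$, and $N(gh)\le N(g)+N(h)$; it induces the left-invariant homogeneous metric $d(g,h)=N(g^{-1}h)$. Here $d$ denotes a homogeneous metric on $G$ and also, abusing notation, a fixed homogeneous metric on each quotient $\pi_i(G)$. $B_G(x,r)=B(x,r)$ is the $d$-ball in $G$. A horizontal line is a set $\{g\exp(tv): t\in\mathbb R\}$ with $g\in G$, $v\in V_1\setminus\{0\}$. $A\cdot B=\{ab:a\in A,b\in B\}$. The stratified $\beta$-number is defined by $$\hat{\beta}_E(x,r)^{2s} := \inf_L \sum_{i=1}^s \sup_{z \in E \cap B(x,r)} \left(\frac{d(\pi_i(z),\pi_i(L))}{r}\right)^{2i},$$ the infimum being over horizontal lines $L\subset G$, distance to a set being the infimum of distances, and a supremum over the empty set being $0$. *)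

(* Defs.v *)
From mathcomp Require Import all_boot all_order all_algebra.
From mathcomp Require Import all_classical all_reals all_analysis.
Import Order.TTheory GRing.Theory Num.Theory.
Import numFieldNormedType.Exports.

Set Implicit Arguments.
Unset Strict Implicit.
Unset Printing Implicit Defensive.

Local Open Scope classical_set_scope.
Local Open Scope ring_scope.

(* Functions of class C^k and C^oo on R^m, by iterated partial derivatives. *)
Fixpoint Ck (R : realType) (m : nat) (k : nat) (f : 'rV[R]_m -> R) : Prop :=
  match k with
  | 0%N => continuous f
  | k'.+1 => continuous f /\
      forall j : 'I_m, (forall x, derivable f x (delta_mx 0 j)) /\
                       Ck k' (fun x => 'D_(delta_mx 0 j) f x)
  end.

Definition smooth (R : realType) (m : nat) (f : 'rV[R]_m -> R) : Prop :=
  forall k, Ck k f.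

Definition lin_span (R : realType) (n : nat) (A : set 'rV[R]_n) : set 'rV[R]_n :=
  [set x | exists (k : nat) (c : 'I_k -> R) (a : 'I_k -> 'rV[R]_n),
             (forall i, A (a i)) /\ x = \sum_(i < k) c i *: a i].

(* [wt k] is the index of the layer containing the k-th basis vector; hence
   n_i = #|[set k | wt k == i]|. The layer V_i is trivial if i is not a
   weight. *)
Definition layer (R : realType) (n : nat) (wt : 'I_n -> nat) (i : nat) :
  set 'rV[R]_n := [set v | forall k, wt k != i -> v 0 k = 0].

Definition dilation (R : realType) (n : nat) (wt : 'I_n -> nat)
    (a : R) (g : 'rV[R]_n) : 'rV[R]_n :=
  \row_k (a ^+ wt k * g 0 k).

(* The Lie bracket of a Lie group law on R^n in exponential coordinates, where
   the identity is 0, the inverse of g is - g, and T_0 R^n = R^n: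
   Ad_g v = d/dt|_0 (g . tv . g^-1) and [u, v] = d/dt|_0 Ad_(tu) v. *)
Definition lie_Ad (R : realType) (n : nat)
    (mul : 'rV[R]_n -> 'rV[R]_n -> 'rV[R]_n) (g v : 'rV[R]_n) : 'rV[R]_n :=
  'D_v (fun h : 'rV[R]_n => mul (mul g h) (- g)) 0.

Definition lie_bracket (R : realType) (n : nat)
    (mul : 'rV[R]_n -> 'rV[R]_n -> 'rV[R]_n) (u v : 'rV[R]_n) : 'rV[R]_n :=
  'D_u (fun g : 'rV[R]_n => lie_Ad mul g v) 0.

(* A Carnot group of step s in exponential coordinates with respect to a basis
   adapted to the stratification: a Lie group structure on the (simply
   connected) manifold R^n such that
   - t |-> tv is the one-parameter subgroup with initial velocity v, that is,
     exp is the identity map; in particular g^-1 = - g;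
   - the coordinate layers stratify the Lie algebra; the case s <= j of
     [carnot_strat] says that [V_1, V_j] = 0.
   That dilations are automorphisms follows from the stratification; it is
   recorded as a field for convenience. *)
Record carnot (R : realType) (n s : nat) := Carnot {
  wt : 'I_n -> nat;
  cmul : 'rV[R]_n -> 'rV[R]_n -> 'rV[R]_n;
  cmulA : forall f g h, cmul f (cmul g h) = cmul (cmul f g) h;
  cmul0l : forall g, cmul 0 g = g;
  cmul0r : forall g, cmul g 0 = g;
  cmul_smooth : forall k : 'I_n,
    smooth (fun z : 'rV[R]_(n + n) => cmul (lsubmx z) (rsubmx z) 0 k);
  cmul_exp : forall (a b : R) (v : 'rV[R]_n),
    cmul (a *: v) (b *: v) = (a + b) *: v;
  wt_bound : forall k, (0 < wt k <= s)%N;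
  wt_top : exists k, wt k = s;
  carnot_strat : forall j, (0 < j)%N ->
    lin_span [set w | exists u v,
      [/\ layer wt 1 u, layer wt j v & w = lie_bracket cmul u v]]
    = layer wt j.+1;
  dilation_aut : forall (a : R) (g h : 'rV[R]_n), 0 < a ->
    dilation wt a (cmul g h) = cmul (dilation wt a g) (dilation wt a h)
}.

Definition cinv (R : realType) (n s : nat) (G : carnot R n s) (g : 'rV[R]_n) :
  'rV[R]_n := - g.

Definition dil (R : realType) (n s : nat) (G : carnot R n s) (a : R)
    (g : 'rV[R]_n) : 'rV[R]_n := dilation (wt G) a g.

(* The quotient pi_i(G) = G / exp(V_(i+1) + ... + V_s), with coordinates
   (g_1, ..., g_i), is represented by the vectors of R^n whose components of
   weight > i vanish, with the group law carried over by the projection. For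
   i = s the projection is the identity and pi_s(G) = G. *)
Definition cproj (R : realType) (n s : nat) (G : carnot R n s) (i : nat)
    (g : 'rV[R]_n) : 'rV[R]_n :=
  \row_k (if (wt G k <= i)%N then g 0 k else 0).

Definition quot (R : realType) (n s : nat) (G : carnot R n s) (i : nat) :
  set 'rV[R]_n := range (cproj G i).

Definition qmul (R : realType) (n s : nat) (G : carnot R n s) (i : nat)
    (g h : 'rV[R]_n) : 'rV[R]_n := cproj G i (cmul G g h).

Definition homog_norm (R : realType) (n s : nat) (G : carnot R n s) (i : nat)
    (N : 'rV[R]_n -> R) : Prop :=
  [/\ forall g, quot G i g -> 0 <= N g,
      forall g, quot G i g -> N (cinv G g) = N g,
      forall (a : R) g, 0 < a -> quot G i g -> N (dil G a g) = a * N g,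
      forall g, quot G i g -> (N g = 0 <-> g = 0) &
      forall g h, quot G i g -> quot G i h -> N (qmul G i g h) <= N g + N h].

(* The homogeneous metric on pi_i(G) induced by N i; [hdist G N s] is the
   metric of G itself. *)
Definition hdist (R : realType) (n s : nat) (G : carnot R n s)
    (N : nat -> 'rV[R]_n -> R) (i : nat) (g h : 'rV[R]_n) : R :=
  N i (qmul G i (cinv G g) h).

Definition hball (R : realType) (n s : nat) (G : carnot R n s)
    (N : nat -> 'rV[R]_n -> R) (x : 'rV[R]_n) (r : R) : set 'rV[R]_n :=
  [set y | hdist G N s x y < r].

Definition horiz_line (R : realType) (n s : nat) (G : carnot R n s)
    (L : set 'rV[R]_n) : Prop :=
  exists g v : 'rV[R]_n, [/\ layer (wt G) 1 v, v != 0 &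
    L = [set y | exists t : R, y = cmul G g (t *: v)]].

Definition dist_set (R : realType) (n : nat) (d : 'rV[R]_n -> 'rV[R]_n -> R)
    (z : 'rV[R]_n) (A : set 'rV[R]_n) : R :=
  inf [set d z a | a in A].

Definition cprod (R : realType) (n s : nat) (G : carnot R n s)
    (A B : set 'rV[R]_n) : set 'rV[R]_n :=
  [set y | exists a b, [/\ A a, B b & y = cmul G a b]].

(* Euclidean norm, up to the fixed scalar multiple c > 0. *)
Definition euc_norm (R : realType) (n : nat) (c : R) (g : 'rV[R]_n) : R :=
  c * Num.sqrt (\sum_(k < n) g 0 k ^+ 2).

Definition euc_ball (R : realType) (n : nat) (c e : R) : set 'rV[R]_n :=
  [set g | euc_norm c g < e].

(* A left-invariant Riemannian metric tensor, given by its Gram matrices in the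
   coordinates of G. *)
Definition left_inv_riem (R : realType) (n s : nat) (G : carnot R n s)
    (Q : 'rV[R]_n -> 'M[R]_n) : Prop :=
  [/\ forall i j, smooth (fun p => Q p i j),
      forall p, (Q p)^T = Q p,
      forall p (v : 'rV[R]_n), v != 0 -> 0 < (v *m Q p *m v^T) 0 0 &
      forall g h v w : 'rV[R]_n,
        ('D_v (cmul G g) h : 'rV[R]_n) *m Q (cmul G g h)
           *m ('D_w (cmul G g) h : 'rV[R]_n)^T
        = v *m Q h *m w^T].

Definition C1_curve (R : realType) (n : nat) (c : R -> 'rV[R]_n) : Prop :=
  (forall t : R, derivable c t 1) /\ continuous (derive1 c : R -> 'rV[R]_n).

Definition riem_length (R : realType) (n : nat) (Q : 'rV[R]_n -> 'M[R]_n)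
    (c : R -> 'rV[R]_n) : R :=
  \int[lebesgue_measure]_(t in `[0, 1])
    Num.sqrt (((derive1 c t : 'rV[R]_n) *m Q (c t)
                 *m (derive1 c t : 'rV[R]_n)^T) 0 0).

(* Curves on [0, 1] are restrictions of curves defined on the whole line. *)
Definition riem_dist (R : realType) (n : nat) (Q : 'rV[R]_n -> 'M[R]_n)
    (x y : 'rV[R]_n) : R :=
  inf [set riem_length Q c | c in
        [set c | [/\ C1_curve c, c 0 = x & c 1 = y]]].

(* Supremum in [0, +oo] of the nonnegative values of f on A, with value 0 when
   A is empty. *)
Definition esup_on (R : realType) (T : Type) (A : set T) (f : T -> R) : \bar R :=
  ereal_sup (0%E |` [set (f z)%:E | z in A]).

Definition strat_beta (R : realType) (n s : nat) (G : carnot R n s)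
    (N : nat -> 'rV[R]_n -> R) (E : set 'rV[R]_n) (x : 'rV[R]_n) (r : R) :
    \bar R :=
  ((ereal_inf
      [set (\sum_(1 <= i < s.+1)
              esup_on (E `&` hball G N x r)
                (fun z => ((dist_set (hdist G N i) (cproj G i z)
                              (cproj G i @` L) / r) ^+ (2 * i))%R))%E
       | L in horiz_line G]) `^ ((2 * s)%:R^-1))%E.

Definition euc_flatness (R : realType) (n s : nat) (G : carnot R n s)
    (N : nat -> 'rV[R]_n -> R) (c : R) (E : set 'rV[R]_n) (x : 'rV[R]_n)
    (r : R) : \bar R :=
  ereal_inf
    [set ereal_inf [set e%:E | e in
       [set e : R | 0 < e /\
          E `&` hball G N x r `<=`
          cprod G L (dil G r @` euc_ball c (e ^+ s))]]
     | L in horiz_line G].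

Definition riem_flatness (R : realType) (n s : nat) (G : carnot R n s)
    (N : nat -> 'rV[R]_n -> R) (Q : 'rV[R]_n -> 'M[R]_n) (E : set 'rV[R]_n)
    (x : 'rV[R]_n) (r : R) : \bar R :=
  ereal_inf
    [set esup_on
       ((dil G r^-1 @` (cmul G (cinv G x) @` E)) `&` hball G N 0 1)
       (fun z => dist_set (riem_dist Q) z L `^ s%:R^-1)
     | L in horiz_line G].

Definition comparable_upto (R : realType) (C : R) (a b : \bar R) : Prop :=
  (a <= C%:E * b)%E /\ (b <= C%:E * a)%E.

(* Main.v *)
(* After translating by x^-1 and dilating by 1/r, all three quantities are
   compared with the least e for which every z in the rescaled set has a point
   a on the line with |a^-1 z| <= e^s.

   For (1), homogeneity and compactness of the unit sphere make each N_i
   equivalent to max_k |g_k|^(1/wt k), so a point with |a^-1 z| <= e^s satisfies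
   d(pi_i z, pi_i a) <= K e^(s/i). Conversely, points a_i of the line realizing
   d(pi_i z, pi_i L) <= e^(s/i) may depend on i, but a_1 works for all i
   simultaneously: the i-th layer of a_1^-1 z differs from that of a_i^-1 z by a
   Lipschitz function, vanishing at 0, of the lower layers of a_1^-1 z.

   For (3), z and the nearby points of the line stay in a fixed bounded set after
   rescaling, and there the Riemannian distance is bilipschitz to |a^-1 z| at
   small scales.

   The group law enters only through two properties, deduced from smoothness and
   the dilations rather than from the Baker-Campbell-Hausdorff formula: it is
   locally Lipschitz, and its coordinate of weight d is the sum of those of the
   factors plus a function of their coordinates of weight < d. *)
Require Import Defs.
From mathcomp Require Import all_boot all_order all_algebra.
From mathcomp Require Import all_classical all_reals all_analysis.
From mathcomp Require Import lra.
Import Order.TTheory GRing.Theory Num.Theory.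
Import numFieldNormedType.Exports.

Set Implicit Arguments.
Unset Strict Implicit.
Unset Printing Implicit Defensive.

Local Open Scope classical_set_scope.
Local Open Scope ring_scope.

(** * Functions of class C^1 *)

Section sup_norm.
Variables (R : realType) (n : nat).
Implicit Types x : 'rV[R]_n.

Lemma coord_le_norm x k : `|x 0 k| <= `|x|.
Proof.
by rewrite [leRHS]/Num.norm /= mx_normrE; apply/bigmax_geP; right; exists (0, k).
Qed.

Lemma row_norm_le x (M : R) : 0 <= M -> (forall k, `|x 0 k| <= M) -> `|x| <= M.
Proof.
move=> M0 xM; rewrite [leLHS]/Num.norm /= mx_normrE; apply/bigmax_leP.
by split=> // -[i k] _; rewrite (ord1 i) /=.
Qed.

Lemma compact_sup_ball (M : R) : compact [set x : 'rV[R]_n | `|x| <= M].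
Proof.
apply: bounded_closed_compact.
  by exists M; split=> [|N MN x /= xM]; rewrite ?num_real// (le_trans xM)// ltW.
apply: (@preimage_closed _ _ (fun x : 'rV[R]_n => `|x|) [set r | r <= M]).
  by move=> x _; exact: norm_continuous.
exact: closed_le.
Qed.

Lemma continuous_sup_ball_bounded (f : 'rV[R]_n -> R) (M : R) :
  continuous f -> exists2 K : R, 0 < K & forall x, `|x| <= M -> `|f x| <= K.
Proof.
move=> cf.
have /compact_bounded [K [_ fK]] : compact (f @` [set x | `|x| <= M]).
  apply: continuous_compact; last exact: compact_sup_ball.
  exact: continuous_subspaceT.
exists (`|K| + 1) => [|x xM]; first by rewrite ltr_wpDl.
by apply: fK; [rewrite (le_lt_trans (ler_norm _))// ltrDl|exists x].
Qed.

End sup_norm.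

Lemma norm_delta_mx (R : realType) (n : nat) (j : 'I_n) :
  `|delta_mx 0 j : 'rV[R]_n| = 1.
Proof.
apply/eqP; rewrite eq_le; apply/andP; split.
  by apply: row_norm_le => // k; rewrite mxE normr_nat; case: (_ && _).
by have := coord_le_norm (delta_mx 0 j : 'rV[R]_n) j; rewrite mxE !eqxx normr1.
Qed.

Section partial_derivatives.
Variables (R : realType) (n : nat).
Implicit Types (f : 'rV[R]_n -> R) (j : 'I_n).

Lemma is_derive_line f (z v : 'rV[R]_n) (s : R) :
  derivable f (z + s *: v) v ->
  is_derive s 1 (fun t : R => f (z + t *: v)) ('D_v f (z + s *: v)).
Proof.
move=> df.
have E : (fun h : R => h^-1 *: (((fun t : R => f (z + t *: v)) \o shift s)
           (h *: (1 : R)) - f (z + s *: v))) =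
         (fun h : R => h^-1 *: ((f \o shift (z + s *: v)) (h *: v) -
           f (z + s *: v))).
  apply/funext => h /=; congr (_ *: (f _ - _)).
  by rewrite /= [h *: _]mulr1 scalerDl addrCA.
by apply: DeriveDef; rewrite /derivable /derive E.
Qed.

(** The mean value theorem on a coordinate line. Locating the intermediate point only by
    [|u| <= |t|] treats both signs of [t] at once. *)
Lemma partial_MVT f j (z : 'rV[R]_n) (t : R) :
  (forall x, derivable f x (delta_mx 0 j)) ->
  exists2 u : R, `|u| <= `|t| &
    f (z + t *: delta_mx 0 j) - f z =
      t * 'D_(delta_mx 0 j) f (z + u *: delta_mx 0 j).
Proof.
move=> df; pose g (s : R) := f (z + s *: delta_mx 0 j).
have dg (s : R) : is_derive s (1 : R) g ('D_(delta_mx 0 j) f (z + s *: delta_mx 0 j)).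
  exact: is_derive_line.
have cg : continuous g.
  move=> s; apply/differentiable_continuous/derivable1_diffP.
  by case: (dg s).
have g0 : g (0 : R) = f z by rewrite /g scale0r addr0.
have [t0|t0] := leP 0 t.
  have [|u] := MVT_segment t0 (fun x _ => dg x); first exact: continuous_subspaceT.
  rewrite in_itv /= g0 subr0 => /andP[u0 ut] gE.
  by exists u; rewrite ?(ger0_norm u0) ?(ger0_norm t0)// [LHS]gE mulrC.
have [|u] := MVT_segment (ltW t0) (fun x _ => dg x).
  exact: continuous_subspaceT.
rewrite in_itv /= g0 sub0r => /andP[ut u0] gE.
exists u; first by rewrite !ler0_norm ?lerN2// ltW.
by rewrite -[LHS]opprB -/(g t) gE mulrN opprK mulrC.
Qed.

(** Move from [y] to [x] one coordinate at a time, applying the mean value theorem and a bound on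
    the corresponding partial derivative at each step. *)
Lemma C1_lipschitz f (M : R) : Ck 1 f ->
  exists2 K : R, 0 < K & forall x y, `|x| <= M -> `|y| <= M ->
    `|f x - f y| <= K * `|x - y|.
Proof.
move=> [_ df].
(* The intermediate points have norm at most [M + 2 * M]: a vertex of the path plus a move by at
   most [|x - y|]. *)
have /choice[K KP] : forall j : 'I_n, exists K : R, 0 < K /\
    forall x, `|x| <= 3 * M -> `|'D_(delta_mx 0 j) f x| <= K.
  by move=> j; have [K K0 fK] := continuous_sup_ball_bounded (3 * M) (df j).2;
     exists K.
exists (1 + \sum_j K j).
  by rewrite ltr_pwDl// sumr_ge0// => j _; have [/ltW] := KP j.
move=> x y xM yM.
(* The vertices of the path: [h 0] is [y] and [h n] is [x]. *)
pose h (l : nat) : 'rV[R]_n := \row_j (if (j < l)%N then x 0 j else y 0 j).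
have M0 : 0 <= M by exact: le_trans xM.
have hM l : `|h l| <= M.
  apply: row_norm_le => // k; rewrite mxE; case: ifP => _.
    by rewrite (le_trans (coord_le_norm _ _)).
  by rewrite (le_trans (coord_le_norm _ _)).
have xyj (j : 'I_n) : `|x 0 j - y 0 j| <= `|x - y|.
  by have := coord_le_norm (x - y) j; rewrite !mxE.
have hstep (j : 'I_n) : `|f (h j.+1) - f (h j)| <= K j * `|x - y|.
  have [u uxy] := partial_MVT (h j) (x 0 j - y 0 j) (df j).1.
  have -> : h j + (x 0 j - y 0 j) *: delta_mx 0 j = h j.+1.
    apply/rowP => i; rewrite !mxE ltnS eqxx /=.
    have [->|ij] := eqVneq i j; first by rewrite ltnn leqnn mulr1 subrKC.
    by rewrite mulr0 addr0 [in RHS]leq_eqVlt -[(_ == _ :> nat)]/(i == j) (negPf ij).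
  rewrite -/(h j) => ->; rewrite normrM mulrC ler_pM//.
  have [_ ->//] := KP j.
  rewrite (le_trans (ler_normD _ _))// (_ : 3 * M = M + 2 * M); last by lra.
  rewrite lerD// normrZ norm_delta_mx mulr1 (le_trans uxy)//.
  rewrite (le_trans (xyj j))//.
  by rewrite (le_trans (ler_normB _ _))// mulr2n mulrDl !mul1r lerD.
have tele l : (l <= n)%N ->
    `|f (h l) - f (h 0%N)| <= \sum_(j < n | (j < l)%N) K j * `|x - y|.
  elim: l => [_|l IH ln]; first by rewrite subrr normr0 sumr_ge0.
  rewrite (bigD1 (Ordinal ln))//= (le_trans (ler_distD (f (h l)) _ _))// lerD//.
    exact: (hstep (Ordinal ln)).
  rewrite (le_trans (IH (ltnW ln)))// le_eqVlt; apply/orP; left; apply/eqP.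
  apply: eq_bigl => j; rewrite ltnS [in RHS]leq_eqVlt -val_eqE /=.
  by case: ltngtP.
have := tele n (leqnn n).
have -> : h n = x by apply/rowP => i; rewrite mxE ltn_ord.
have -> : h 0%N = y by apply/rowP => i; rewrite mxE.
move=> /le_trans; apply; rewrite -mulr_suml ler_wpM2r//.
under eq_bigl do rewrite ltn_ord.
by rewrite lerDr.
Qed.

End partial_derivatives.

(** * Smooth functions homogeneous under dilations *)

Section dilation.
Variables (R : realType) (n : nat) (w : 'I_n -> nat).
Implicit Types (a t : R) (z : 'rV[R]_n).

Lemma dilation_line a t z j :
  dilation w a (z + t *: delta_mx 0 j) =
  dilation w a z + (a ^+ w j * t) *: delta_mx 0 j.
Proof.
apply/rowP => k; rewrite !mxE eqxx /=.
have [->|] := eqVneq k j; first by rewrite !mulr1 mulrDr.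
by rewrite !mulr0 !addr0.
Qed.

Lemma dilation_norm_le a z : (forall k, (0 < w k)%N) -> 0 <= a <= 1 ->
  `|dilation w a z| <= a * `|z|.
Proof.
move=> w0 /andP[a0 a1]; apply: row_norm_le => [|k]; first by rewrite mulr_ge0.
rewrite mxE normrM ger0_norm ?exprn_ge0// ler_pM ?exprn_ge0 ?coord_le_norm//.
by rewrite ler_iXnr.
Qed.

(** By homogeneity the increment of [f] is [a ^- d] times its increment between the dilated points,
    which differ by [a ^+ w j * t]. The Lipschitz bound leaves [a ^+ (w j - d)], which tends to 0
    with [a]. *)
Lemma homogeneous_high_coord (f : 'rV[R]_n -> R) (d : nat) j z t :
  Ck 1 f -> (forall k, (0 < w k)%N) ->
  (forall a x, 0 < a -> f (dilation w a x) = a ^+ d * f x) ->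
  (d < w j)%N -> f (z + t *: delta_mx 0 j) = f z.
Proof.
move=> Cf w0 fhom dj; pose M := `|z| + `|t|.
have [K K0 fK] := C1_lipschitz M Cf.
apply/eqP; rewrite -subr_eq0 -normr_le0; apply/ler_addgt0Pl => e e0.
rewrite addr0; set D := (X in `|X|).
have bound a : 0 < a -> a <= 1 -> `|D| <= a * (K * `|t|).
  move=> a0 a1.
  have a01 : 0 <= a <= 1 by rewrite ltW.
  have zM : `|z| <= M by rewrite lerDl.
  have ztM : `|z + t *: delta_mx 0 j| <= M.
    by rewrite (le_trans (ler_normD _ _))// normrZ norm_delta_mx mulr1.
  have dM x : `|x| <= M -> `|dilation w a x| <= M.
    move=> xM; rewrite (le_trans (dilation_norm_le _ _ _))//.
    by rewrite (le_trans _ xM)// ler_piMl.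
  have := fK _ _ (dM _ ztM) (dM _ zM).
  rewrite !fhom// -mulrBr -/D normrM gtr0_norm ?exprn_gt0//.
  rewrite dilation_line addrC addKr normrZ norm_delta_mx mulr1 normrM.
  rewrite (gtr0_norm (exprn_gt0 (w j) a0)) mulrCA -(subnK (ltnW dj)) exprD.
  rewrite (mulrC (a ^+ (w j - d))) -mulrA ler_pM2l ?exprn_gt0// => /le_trans; apply.
  by rewrite ler_wpM2r ?mulr_ge0 ?(ltW K0)// ler_iXnr ?subn_gt0 ?(ltW a0)//.
(* Small enough that the bound is at most [e]; the added 1 keeps the denominator positive when
   [t = 0]. *)
pose a := Num.min 1 (e / (K * `|t| + 1)).
have Kt : 0 < K * `|t| + 1 by rewrite ltr_wpDl// mulr_ge0 ?(ltW K0).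
rewrite (le_trans (bound a _ _))// ?ge_min ?lexx//.
  by rewrite lt_min ltr01 divr_gt0.
apply: (@le_trans _ _ (e / (K * `|t| + 1) * (K * `|t|))).
  by rewrite ler_wpM2r ?mulr_ge0 ?(ltW K0)// ge_min lexx orbT.
by rewrite mulrAC ler_pdivrMr// ler_pM2l// lerDl.
Qed.

(** Now the factor [a ^+ d] of homogeneity cancels the one in the dilated step. What remains is [t]
    times the partial derivative at a point that tends to 0 with [a], and this derivative is
    continuous at 0. *)
Lemma homogeneous_top_coord (f : 'rV[R]_n -> R) (d : nat) j z t :
  Ck 1 f -> (forall k, (0 < w k)%N) ->
  (forall a x, 0 < a -> f (dilation w a x) = a ^+ d * f x) ->
  w j = d -> f (z + t *: delta_mx 0 j) = f z + t * 'D_(delta_mx 0 j) f 0.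
Proof.
move=> Cf w0 fhom dj.
have [df cdf] := Cf.2 j.
rewrite [RHS]addrC; apply/eqP; rewrite -subr_eq -subr_eq0 -normr_le0.
apply/ler_addgt0Pl => e e0; rewrite addr0.
have e1 : 0 < e / (`|t| + 1) by rewrite divr_gt0// ltr_wpDl.
have := cdf 0; move/cvgrPdist_le => /(_ _ e1)/nbhs_ballP[r /= r0 rP].
pose M := `|z| + `|t| + 1.
have M0 : 0 < M by rewrite ltr_wpDl// addr_ge0.
have M1 : 0 < M + 1 by rewrite addr_gt0.
(* The intermediate point has norm at most [a * M], hence less than [r]. *)
pose a := Num.min 1 (r / (M + 1)).
have a0 : 0 < a by rewrite lt_min ltr01 divr_gt0.
have a1 : a <= 1 by rewrite ge_min lexx.
have [u uE] := partial_MVT (dilation w a z) (a ^+ d * t) df.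
rewrite -{1}dj -dilation_line !fhom// -mulrBr -mulrA.
move=> /(mulfI (lt0r_neq0 (exprn_gt0 d a0))) ->.
rewrite -mulrBr normrM distrC.
apply: (@le_trans _ _ (`|t| * (e / (`|t| + 1)))); last first.
  by rewrite mulrCA ger_pMr// ler_pdivrMr ?ltr_wpDl// mul1r lerDl.
rewrite ler_wpM2l//; apply: rP; rewrite -ball_normE /ball_ /= sub0r normrN.
rewrite (le_lt_trans (ler_normD _ _))// normrZ norm_delta_mx mulr1.
have d0 : (0 < d)%N by rewrite -dj.
apply: (@le_lt_trans _ _ (a * M)).
  rewrite /M -addrA mulrDr lerD ?dilation_norm_le// ?(ltW a0)//.
  rewrite (le_trans uE)// normrM ger0_norm ?exprn_ge0 ?(ltW a0)//.
  rewrite ler_pM ?exprn_ge0 ?(ltW a0)// ?lerDl//.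
  by rewrite ler_iXnr// (ltW a0).
apply: (@le_lt_trans _ _ (r / (M + 1) * M)).
  by rewrite ler_wpM2r ?(ltW M0)// ge_min lexx orbT.
by rewrite mulrAC ltr_pdivrMr // ltr_pM2l // ltrDl.
Qed.

End dilation.

(** * The group law in coordinates *)

Section carnot_law.
Variables (R : realType) (n s : nat) (G : carnot R n s).
Implicit Types (u v g h : 'rV[R]_n) (a t : R) (i : nat).

Lemma wt_gt0 k : (0 < wt G k)%N. Proof. by have /andP[] := wt_bound G k. Qed.

Lemma cmulVg g : cmul G (- g) g = 0.
Proof. by have := cmul_exp G (-1) 1 g; rewrite scaleN1r scale1r addNr scale0r. Qed.

Lemma cmulgV g : cmul G g (- g) = 0.
Proof. by have := cmulVg (- g); rewrite opprK. Qed.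

Lemma cmulKV g h : cmul G g (cmul G (- g) h) = h.
Proof. by rewrite cmulA cmulgV cmul0l. Qed.

Lemma cmulVK g h : cmul G (- g) (cmul G g h) = h.
Proof. by rewrite cmulA cmulVg cmul0l. Qed.

Lemma cmul_oppr g h : - cmul G g h = cmul G (- h) (- g).
Proof.
rewrite -[RHS](cmulVK (cmul G g h)) -!(cmulA G g) (cmulA G h) cmulgV cmul0l.
by rewrite cmulgV cmul0r.
Qed.

(** A pair dilates as one vector with concatenated weights, so the lemmas on homogeneous functions
    apply to the coordinates of the group law. *)
Lemma dil_row_mx a u v :
  row_mx (dil G a u) (dil G a v) =
  dilation (fun j => match fintype.split j with inl i | inr i => wt G i end) a
    (row_mx u v).
Proof.
apply/rowP => j; rewrite [in RHS]mxE.
by case: split_ordP => i ->; rewrite ?row_mxEl ?row_mxEr mxE.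
Qed.

Let mulc (k : 'I_n) (z : 'rV[R]_(n + n)) : R :=
  cmul G (lsubmx z) (rsubmx z) 0 k.

Let mulcE k u v : mulc k (row_mx u v) = cmul G u v 0 k.
Proof. by rewrite /mulc row_mxKl row_mxKr. Qed.

Lemma delta_mx_lshift (j : 'I_n) :
  delta_mx 0 (lshift n j) =
  row_mx (delta_mx 0 j : 'rV[R]_n) (0 : 'rV[R]_n).
Proof.
apply/rowP => l; case: (split_ordP l) => i ->; rewrite ?row_mxEl ?row_mxEr !mxE.
  by rewrite eq_lshift.
by rewrite eq_rlshift.
Qed.

Lemma delta_mx_rshift (j : 'I_n) :
  delta_mx 0 (rshift n j) =
  row_mx (0 : 'rV[R]_n) (delta_mx 0 j : 'rV[R]_n).
Proof.
apply/rowP => l; case: (split_ordP l) => i ->; rewrite ?row_mxEl ?row_mxEr !mxE.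
  by rewrite eq_lrshift.
by rewrite eq_rshift.
Qed.

Let w2 (j : 'I_(n + n)) : nat :=
  match fintype.split j with inl i | inr i => wt G i end.

Let w2_gt0 j : (0 < w2 j)%N.
Proof. by rewrite /w2; case: fintype.split => i; exact: wt_gt0. Qed.

Let mulc_hom k a z : 0 < a -> mulc k (dilation w2 a z) = a ^+ wt G k * mulc k z.
Proof.
move=> a0; rewrite -[z]hsubmxK -dil_row_mx !mulcE.
by rewrite /dil -dilation_aut// mxE.
Qed.

(** For equal weights the slope is the derivative at 0, which equals the value at the basis vector
    because [0 . 0 = 0]. For larger weight both the increment and that value vanish. *)
Let mulc_line k j z t : (wt G k <= w2 j)%N ->
  mulc k (z + t *: delta_mx 0 j) = mulc k z + t * mulc k (delta_mx 0 j).
Proof.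
rewrite leq_eqVlt => /predU1P[kj|kj].
  have top x r : mulc k (x + r *: delta_mx 0 j) =
      mulc k x + r * 'D_(delta_mx 0 j) (mulc k) 0.
    exact: homogeneous_top_coord (cmul_smooth G k 1) w2_gt0 (@mulc_hom k) _.
  rewrite [LHS]top; congr (_ + t * _).
  have := top 0 1; rewrite add0r scale1r mul1r => ->.
  by rewrite {2}/mulc !linear0 cmul0l mxE add0r.
have high x r : mulc k (x + r *: delta_mx 0 j) = mulc k x.
  exact: homogeneous_high_coord (cmul_smooth G k 1) w2_gt0 (@mulc_hom k) _.
rewrite [LHS]high -[delta_mx _ _]add0r -[delta_mx _ _]scale1r.
by rewrite [X in _ * X]high /mulc !linear0 cmul0l mxE mulr0 addr0.
Qed.

Lemma cmul_linel k j u v t : (wt G k <= wt G j)%N ->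
  cmul G (u + t *: delta_mx 0 j) v 0 k = cmul G u v 0 k + t * (k == j)%:R.
Proof.
move=> kj; have := @mulc_line k (lshift n j) (row_mx u v) t.
rewrite /w2 -[lshift n j]/(unsplit (inl j)) unsplitK => /(_ kj) /=.
rewrite delta_mx_lshift scale_row_mx add_row_mx !mulcE.
by rewrite scaler0 addr0 cmul0r mxE eqxx.
Qed.

Lemma cmul_liner k j u v t : (wt G k <= wt G j)%N ->
  cmul G u (v + t *: delta_mx 0 j) 0 k = cmul G u v 0 k + t * (k == j)%:R.
Proof.
move=> kj; have := @mulc_line k (rshift n j) (row_mx u v) t.
rewrite /w2 -[rshift n j]/(unsplit (inr j)) unsplitK => /(_ kj) /=.
rewrite delta_mx_rshift scale_row_mx add_row_mx !mulcE.
by rewrite scaler0 addr0 cmul0l mxE eqxx.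
Qed.

(** Change [v] into [u] one coordinate at a time. In directions of weight at least [wt G k] the
    function [f x - x 0 k] is constant; in the others there is nothing to change. *)
Let sub_coord_low k (f : 'rV[R]_n -> R) u v :
  (forall j x t, (wt G k <= wt G j)%N ->
    f (x + t *: delta_mx 0 j) = f x + t * (k == j)%:R) ->
  (forall j, (wt G j < wt G k)%N -> u 0 j = v 0 j) ->
  f u - u 0 k = f v - v 0 k.
Proof.
move=> fline uv.
have -> : u = v + \sum_(j <- index_enum 'I_n) (u 0 j - v 0 j) *: delta_mx 0 j.
  rewrite -[LHS](subrKC v); congr (_ + _); rewrite [LHS]row_sum_delta.
  by apply: eq_bigr => j _; rewrite !mxE.
elim: (index_enum _) => [|j r IH]; first by rewrite big_nil addr0.
rewrite big_cons [_ + (_ *: _ + _)]addrCA [_ *: _ + _]addrC.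
have [kj|/uv ->] := leqP (wt G k) (wt G j); last by rewrite subrr scale0r addr0.
rewrite fline// [in X in _ - X]mxE [in X in _ - (_ + X)]mxE [delta_mx _ _ _ _]mxE.
by rewrite eqxx opprD addrACA subrr addr0.
Qed.

(* The coordinate of weight d of a product is the sum of the coordinates of the
   factors plus a function of their coordinates of weight < d. *)
Lemma cmul_coord_low k u v u' v' :
  (forall j, (wt G j < wt G k)%N -> u 0 j = u' 0 j) ->
  (forall j, (wt G j < wt G k)%N -> v 0 j = v' 0 j) ->
  cmul G u v 0 k - u 0 k - v 0 k = cmul G u' v' 0 k - u' 0 k - v' 0 k.
Proof.
move=> uu vv; transitivity (cmul G u' v 0 k - u' 0 k - v 0 k).
  congr (_ - _); apply: (sub_coord_low (f := fun x => cmul G x v 0 k)) uu.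
  by move=> j x t; exact: cmul_linel.
rewrite [LHS]addrAC [RHS]addrAC; congr (_ - _).
apply: (sub_coord_low (f := fun x => cmul G u' x 0 k)) vv.
by move=> j x t; exact: cmul_liner.
Qed.

Lemma cmul_coord_add k u v :
  (forall j, (wt G j < wt G k)%N -> u 0 j = 0) ->
  (forall j, (wt G j < wt G k)%N -> v 0 j = 0) ->
  cmul G u v 0 k = u 0 k + v 0 k.
Proof.
move=> u0 v0; have := @cmul_coord_low k u v 0 0.
rewrite cmul0l !mxE !subr0 -addrA -opprD => H; apply/eqP.
rewrite -subr_eq0 H// => j jk; rewrite mxE; [exact: u0|exact: v0].
Qed.

(** This makes the projection a homomorphism: coordinates of weight at most [i] of a product see
    only such coordinates of the factors. *)
Lemma cproj_cmul i u v :
  cproj G i (cmul G u v) = cproj G i (cmul G (cproj G i u) (cproj G i v)).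
Proof.
apply/rowP => k; rewrite !mxE; case: ifP => // ki.
have low (x : 'rV[R]_n) j : (wt G j <= wt G k)%N -> x 0 j = cproj G i x 0 j.
  by move=> jk; rewrite mxE (leq_trans jk).
have := @cmul_coord_low k u v (cproj G i u) (cproj G i v).
rewrite -!low// => H; apply/(addIr (- u 0 k))/(addIr (- v 0 k))/H.
  by move=> j /ltnW; exact: low.
by move=> j /ltnW; exact: low.
Qed.

Lemma cmul_lipschitz (M : R) : exists2 K : R, 0 < K &
  forall u v u' v', `|u| <= M -> `|v| <= M -> `|u'| <= M -> `|v'| <= M ->
    `|cmul G u v - cmul G u' v'| <= K * (`|u - u'| + `|v - v'|).
Proof.
have /choice[K KP] : forall k : 'I_n, exists K : R, 0 < K /\
    forall x y, `|x| <= M -> `|y| <= M -> `|mulc k x - mulc k y| <= K * `|x - y|.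
  by move=> k; have [K K0 fK] := C1_lipschitz M (cmul_smooth G k 1); exists K.
exists (1 + \sum_k K k).
  by rewrite ltr_pwDl// sumr_ge0// => j _; have [/ltW] := KP j.
move=> u v u' v' uM vM u'M v'M.
have K0 : 0 <= 1 + \sum_k K k.
  by rewrite addr_ge0// sumr_ge0// => j _; have [/ltW] := KP j.
have row_le (x y : 'rV[R]_n) (B : R) : `|x| <= B -> `|y| <= B -> `|row_mx x y| <= B.
  move=> xB yB; apply: row_norm_le => [|j]; first exact: le_trans xB.
  by case: (split_ordP j) => l ->; rewrite ?row_mxEl ?row_mxEr;
    rewrite (le_trans (coord_le_norm _ _)).
apply: row_norm_le => [|k]; first by rewrite mulr_ge0// addr_ge0.
have [K0k HK] := KP k.
rewrite 2!mxE -!mulcE (le_trans (HK _ _ _ _))//; [exact: row_le|exact: row_le|].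
rewrite opp_row_mx add_row_mx ler_pM//; [exact: ltW| |].
  rewrite (bigD1 k)//= addrCA lerDl addr_ge0// sumr_ge0// => j _.
  by have [/ltW] := KP j.
by apply: row_le; rewrite ?lerDl ?lerDr.
Qed.

End carnot_law.

(** * Homogeneous norms *)

Lemma nneg_root (R : realType) (t : R) (d : nat) : 0 <= t -> (0 < d)%N ->
  exists2 a : R, 0 <= a & a ^+ d = t.
Proof.
move=> t0 d0; exists (t `^ d%:R^-1); first exact: powR_ge0.
by rewrite -powR_mulrn ?powR_ge0// -powRrM mulVf ?powRr1// pnatr_eq0 -lt0n.
Qed.

(** * The quotient groups in coordinates *)

Section quotient.
Variables (R : realType) (n s : nat) (G : carnot R n s) (i : nat).
Implicit Types (u v g h : 'rV[R]_n) (a t : R).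

Lemma quotP g : quot G i g <-> forall k, (i < wt G k)%N -> g 0 k = 0.
Proof.
split=> [[h _ <-] k ik|g0]; first by rewrite mxE leqNgt ik.
by exists g => //; apply/rowP => k; rewrite mxE leqNgt; case: ltnP => // /g0 ->.
Qed.

Lemma cproj_id g : quot G i g -> cproj G i g = g.
Proof.
move=> /quotP g0; apply/rowP => k; rewrite mxE leqNgt.
by case: ltnP => // /g0 ->.
Qed.

Lemma quot_cproj g : quot G i (cproj G i g). Proof. by exists g. Qed.

Lemma quot_qmul g h : quot G i (qmul G i g h). Proof. exact: quot_cproj. Qed.

Lemma quot_dil a g : quot G i g -> quot G i (dil G a g).
Proof. by move=> /quotP g0; apply/quotP => k /g0; rewrite mxE => ->; rewrite mulr0. Qed.

Lemma qmulKV g h : quot G i h -> qmul G i g (qmul G i (- g) h) = h.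
Proof.
move=> qh; rewrite /qmul cproj_cmul (cproj_id (quot_cproj _)) -cproj_cmul.
by rewrite cmulKV cproj_id.
Qed.

Lemma cprojN g : cproj G i (- g) = - cproj G i g.
Proof. by apply/rowP => k; rewrite !mxE; case: ifP; rewrite ?oppr0. Qed.

Lemma qmul_oppr g h : - qmul G i g h = qmul G i (- h) (- g).
Proof. by rewrite /qmul -cprojN cmul_oppr. Qed.

Lemma cproj_norm_le g : `|cproj G i g| <= `|g|.
Proof.
apply: row_norm_le => // k; rewrite mxE; case: ifP; rewrite ?normr0// => _.
exact: coord_le_norm.
Qed.

Lemma cproj_dil a g : cproj G i (dil G a g) = dil G a (cproj G i g).
Proof. by apply/rowP => k; rewrite !mxE; case: ifP; rewrite ?mulr0. Qed.

End quotient.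

(** * Boundedness, continuity and coordinate estimates for homogeneous norms *)

Section homogeneous_norm.
Variables (R : realType) (n s : nat) (G : carnot R n s) (i : nat).
Variables (N : 'rV[R]_n -> R) (hN : homog_norm G i N).
Implicit Types (u v g h : 'rV[R]_n) (a t : R).

Let N_ge0 g : quot G i g -> 0 <= N g. Proof. by case: hN => + _ _ _ _; exact. Qed.
Let N_opp g : quot G i g -> N (- g) = N g. Proof. by case: hN => _ + _ _ _; exact. Qed.
Let N_dil a g : 0 < a -> quot G i g -> N (dil G a g) = a * N g.
Proof. by case: hN => _ _ + _ _; exact. Qed.
Let N_eq0 g : quot G i g -> (N g = 0 <-> g = 0).
Proof. by case: hN => _ _ _ + _; exact. Qed.
Let N_mul g h : quot G i g -> quot G i h -> N (qmul G i g h) <= N g + N h.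
Proof. by case: hN => _ _ _ _; exact. Qed.

Let quot0 : quot G i (0 : 'rV[R]_n). Proof. by apply/quotP => k _; rewrite mxE. Qed.

Let N0 : N 0 = 0. Proof. by apply/(N_eq0 quot0). Qed.

(** For [t >= 0] the point is the dilate of the basis vector by the root [a] of [t] of order
    [wt G k], and [a <= 1 + t] whether or not [a <= 1]. Symmetry of [N] covers negative [t]. *)
Lemma homog_norm_axis k t : (wt G k <= i)%N ->
  N (t *: delta_mx 0 k) <= (1 + `|t|) * N (delta_mx 0 k).
Proof.
move=> ki.
have qe x : quot G i (x *: delta_mx 0 k : 'rV[R]_n).
  apply/quotP => l il; rewrite !mxE eqxx /=.
  by case: eqP => [lk|]; rewrite ?mulr0//; move: il; rewrite lk ltnNge ki.
have qe1 : quot G i (delta_mx 0 k : 'rV[R]_n) by rewrite -[delta_mx _ _]scale1r.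
wlog t0 : t / 0 <= t.
  move=> H; have [/H//|/ltW t0] := leP 0 t.
  by rewrite -N_opp// -scaleNr -normrN H ?oppr_ge0.
rewrite ger0_norm//; have [a a0 at_] := nneg_root t0 (wt_gt0 G k).
have [aE|aN0] := eqVneq a 0.
  move: at_; rewrite aE expr0n gtn_eqF ?wt_gt0//= => <-.
  by rewrite scale0r N0 mulr_ge0 ?N_ge0// addr_ge0.
have -> : t *: delta_mx 0 k = dil G a (delta_mx 0 k).
  apply/rowP => l; rewrite !mxE eqxx /=; case: eqP => [->|]; last by rewrite !mulr0.
  by rewrite at_.
rewrite N_dil ?lt_def ?aN0//; rewrite ler_wpM2r ?N_ge0//.
have [a1|a1] := leP a 1; first by rewrite (le_trans a1)// lerDl.
apply: (@le_trans _ _ t); last by rewrite lerDr.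
by rewrite -at_ ler_eXnr ?wt_gt0// ltW.
Qed.

(** Continuity is not part of the definition of a homogeneous norm, so boundedness comes from
    subadditivity: split off one axis factor at a time, in order of increasing weight. [S] collects
    the coordinates already cleared, and [m] bounds the number of the others. *)
Lemma homog_norm_bounded_subset (m : nat) (S : {set 'I_n}) (M : R) :
  (#|~: S| <= m)%N ->
  (forall j l, l \in S -> (wt G j < wt G l)%N -> j \in S) ->
  exists K : R, forall g, quot G i g -> (forall k, k \in S -> g 0 k = 0) ->
    `|g| <= M -> N g <= K.
Proof.
elim: m S M => [|m IH] S M.
  rewrite leqn0 cards_eq0 => /eqP S0 _; exists 0 => g _ gS _.
  rewrite (_ : g = 0) ?N0//; apply/rowP => k; rewrite mxE gS//.
  apply: contraT => kS; have : k \in ~: S by rewrite inE.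
    by rewrite S0 inE.
move=> Sm low.
have [S0|/finset.set0Pn[k0 k0S]] := eqVneq (~: S) finset.set0.
  by apply: (IH S M) => //; rewrite S0 cards0.
pose k := [arg min_(k < k0 in ~: S) wt G k].
have [kS kmin] : k \in ~: S /\ forall j, j \in ~: S -> (wt G k <= wt G j)%N.
  by rewrite /k; case: arg_minnP.
rewrite inE in kS.
have klow j : (wt G j < wt G k)%N -> j \in S.
  by apply: contraTT => jS; rewrite -leqNgt kmin// inE.
(* If even the least remaining weight exceeds [i], all remaining coordinates vanish in the
   quotient. *)
have [ik|ki] := ltnP i (wt G k).
  exists 0 => g /quotP gq gS _; rewrite (_ : g = 0) ?N0//; apply/rowP => j.
  rewrite mxE; have [/gS//|jS] := boolP (j \in S).
  by rewrite gq// (leq_trans ik)// kmin// inE.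
have [K2 K20 K2P] := cmul_lipschitz G M.
have [|j l|K KP] := IH (k |: S) (K2 * (M + M)).
- rewrite -ltnS (leq_trans _ Sm)// proper_card// properE.
  apply/andP; split; first by rewrite finset.setCS finset.subsetUr.
  by apply/subsetPn; exists k; rewrite !inE ?kS// eqxx.
- rewrite !inE => /predU1P[->|/low lS] jl; first by rewrite klow ?orbT.
  by rewrite lS// orbT.
exists ((1 + M) * N (delta_mx 0 k) + K) => g gq gS gM.
have M0 : 0 <= M by exact: le_trans gM.
pose u : 'rV[R]_n := g 0 k *: delta_mx 0 k.
have uE j : u 0 j = g 0 k * (j == k)%:R by rewrite !mxE eqxx.
have uq : quot G i u.
  apply/quotP => j ij; rewrite uE; case: eqP => [jk|]; rewrite ?mulr0//.
  by move: ij; rewrite jk ltnNge ki.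
have uM : `|u| <= M.
  by rewrite normrZ norm_delta_mx mulr1 (le_trans (coord_le_norm _ _)).
(* Write [g] as [u] times [u^-1 g]. The second factor has its [k]-th coordinate cleared and falls
   under the induction hypothesis. *)
rewrite -(qmulKV u gq) (le_trans (N_mul _ _))//; first exact: quot_qmul.
apply: lerD.
  rewrite (le_trans (homog_norm_axis _ ki))// ler_wpM2r ?N_ge0//.
    apply/quotP => j ij; rewrite mxE /=; case: eqP => [jk|]//.
    by move: ij; rewrite jk ltnNge ki.
  by rewrite lerD2l (le_trans (coord_le_norm _ _)).
apply: KP; first exact: quot_qmul.
  move=> l lkS; rewrite mxE; case: ifP => // _.
  have lS j : (wt G j < wt G l)%N -> j \in S.
    by move: lkS; rewrite !inE => /predU1P[->|]; [exact: klow|exact: low].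
  (* Both factors vanish in weights below that of [l], so their [l]-th coordinates simply add: they
     cancel for [l = k] and are both 0 otherwise. *)
  rewrite cmul_coord_add.
  - rewrite mxE uE; move: lkS; rewrite !inE.
    case/predU1P => [->|lS']; first by rewrite eqxx mulr1 addNr.
    rewrite (gS l)// addr0; case: eqP => [lk|]; rewrite ?mulr0 ?oppr0//.
    by move: kS; rewrite -lk lS'.
  - move=> j /lS jS; rewrite mxE uE; case: eqP => [jk|]; rewrite ?mulr0 ?oppr0//.
    by move: kS; rewrite -jk jS.
  - by move=> j /lS; exact: gS.
rewrite (le_trans (cproj_norm_le _ _ _))//.
have := K2P (- u) g 0 0; rewrite cmul0l !subr0 normrN normr0 => /(_ uM gM M0 M0).
by move=> /le_trans; apply; rewrite ler_pM2l// lerD.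
Qed.

Lemma homog_norm_bounded (M : R) :
  exists2 K : R, 0 < K & forall g, quot G i g -> `|g| <= M -> N g <= K.
Proof.
have [|j l|K KP] :=
  @homog_norm_bounded_subset #|~: finset.set0 : {set 'I_n}| finset.set0 M.
- by [].
- by rewrite inE.
exists (1 + `|K|) => [|g gq gM]; first by rewrite ltr_pwDl.
rewrite (le_trans (KP g gq _ gM)) => [|k|]; [by []|by rewrite inE|].
by rewrite (le_trans (ler_norm _))// lerDr.
Qed.

(** Dilating by [t^-1] moves [g] into the unit ball of the sup norm, where [N] is bounded. *)
Lemma homog_norm_le : exists2 K : R, 0 < K & forall g t, quot G i g -> 0 <= t ->
  (forall k, `|g 0 k| <= t ^+ wt G k) -> N g <= K * t.
Proof.
have [K K0 KP] := homog_norm_bounded 1; exists K => // g t gq.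
rewrite le_eqVlt => /predU1P[<-|t0] gt.
  rewrite mulr0 (_ : g = 0) ?N0//; apply/rowP => k.
  apply/eqP; rewrite mxE -normr_le0 (le_trans (gt k))// expr0n.
  by rewrite gtn_eqF ?wt_gt0.
rewrite -ler_pdivrMr// mulrC -N_dil ?invr_gt0// KP//; first exact: quot_dil.
apply: row_norm_le => // k; rewrite mxE normrM normrX normfV.
by rewrite (gtr0_norm t0) exprVn mulrC ler_pdivrMr ?exprn_gt0// mul1r.
Qed.

(** Subadditivity and symmetry bound the variation of [N] by [N] of [g^-1 h], whose coordinates are
    small because the group law is Lipschitz. *)
Lemma homog_norm_continuous : continuous (fun g => N (cproj G i g)).
Proof.
move=> g; have [K K0 KP] := homog_norm_le.
have [K2 K20 K2P] := cmul_lipschitz G (`|g| + 1).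
apply/(@cvgrPdist_le _ _ _ (nbhs g) (nbhs_filter g)) => e e0.
pose t := Num.min 1 (e / K).
have t0 : 0 < t by rewrite lt_min ltr01 divr_gt0.
have t1 : t <= 1 by rewrite ge_min lexx.
have tKe : K * t <= e by rewrite mulrC -ler_pdivlMr// ge_min lexx orbT.
(* At this radius the coordinates of [g^-1 h] are at most [t ^+ s], hence at most [t ^+ wt G k]
   since [t <= 1]. *)
have d0 : 0 < Num.min 1 (t ^+ s / K2) by rewrite lt_min ltr01 divr_gt0// exprn_gt0.
apply/nbhs_ballP; exists (Num.min 1 (t ^+ s / K2)) => //= h.
rewrite -ball_normE /ball_ /= lt_min => /andP[gh1 ghd].
have hg : `|h| <= `|g| + 1.
  by rewrite -[h](subrK g) (le_trans (ler_normD _ _))// addrC lerD2l distrC ltW.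
pose w := qmul G i (- cproj G i g) (cproj G i h).
have Nw : N w <= K * t.
  apply: KP; [exact: quot_qmul|exact: ltW|move=> k].
  apply: (@le_trans _ _ (t ^+ s)); last first.
    by apply: ler_wiXn2l; rewrite ?(ltW t0)//; have /andP[] := wt_bound G k.
  rewrite (le_trans (coord_le_norm _ _))// /w /qmul -cprojN -cproj_cmul.
  rewrite (le_trans (cproj_norm_le _ _ _))//.
  have := K2P (- g) h (- g) g; rewrite cmulVg subr0 subrr normr0 add0r normrN.
  have gg : `|g| <= `|g| + 1 by rewrite lerDl.
  move=> /(_ gg hg gg gg) /le_trans; apply.
  by rewrite mulrC -ler_pdivlMr// distrC ltW.
have qg := quot_cproj G i g; have qh := quot_cproj G i h.
rewrite (le_trans _ tKe)// (le_trans _ Nw)// ler_norml; apply/andP; split.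
  rewrite lerBrDl lerBlDr -{1}(qmulKV (cproj G i g) qh).
  by apply: N_mul => //; exact: quot_qmul.
rewrite lerBlDl -{1}(qmulKV (cproj G i h) qg) (le_trans (N_mul _ _))//.
  exact: quot_qmul.
by rewrite lerD2l -N_opp ?qmul_oppr ?opprK//; exact: quot_qmul.
Qed.

(** The minimum over the compact sphere is attained, and it is positive because [N] vanishes only at
    0. On an empty sphere any constant serves. *)
Lemma homog_norm_sphere_ge : exists2 m : R, 0 < m &
  forall g, quot G i g -> `|g| = 1 -> m <= N g.
Proof.
pose A : set 'rV[R]_n := [set g | quot G i g /\ `|g| = 1].
have [A0|A0] := pselect (A !=set0); last first.
  by exists 1 => // g gq g1; exfalso; apply: A0; exists g.
have cA : compact A.
  apply: (subclosed_compact _ (@compact_sup_ball R n 1)); last by move=> g [_ /= ->].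
  have -> : A = \bigcap_(k in [set k : 'I_n | (i < wt G k)%N])
      [set g : 'rV[R]_n | g 0 k = 0] `&` [set g | `|g| = 1].
    apply/seteqP; split=> g /= [gq g1]; split=> //.
      by move=> k; move/quotP: gq; exact.
    by apply/quotP => k; exact: gq.
  apply: closedI.
    apply: closed_bigI => k _; apply: (@preimage_closed _ _ (fun g : 'rV[R]_n => g 0 k)
      [set x | x = 0]); last exact: closed_eq.
    by move=> g _; exact: coord_continuous.
  apply: (@preimage_closed _ _ (fun g : 'rV[R]_n => `|g|) [set x | x = 1]).
    by move=> g _; exact: norm_continuous.
  exact: closed_eq.
have [g0] := EVT_min_rV A0 cA (continuous_subspaceT homog_norm_continuous).
rewrite inE => -[g0q g01] g0min; exists (N g0).
  rewrite lt_def N_ge0// andbT; apply/eqP => /(N_eq0 g0q) g00.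
  by move: g01; rewrite g00 normr0 => /eqP; rewrite eq_sym oner_eq0.
move=> g gq g1; have := g0min g; rewrite inE !cproj_id//; exact.
Qed.

(** With [T] the maximum of the roots [|g_j|^(1 / wt j)], the dilate of [g] by [T^-1] lies on the
    unit sphere, so [m * T <= N g]. *)
Lemma homog_norm_coord_le : exists2 K : R, 0 < K &
  forall g k, quot G i g -> `|g 0 k| <= (K * N g) ^+ wt G k.
Proof.
have [m m0 mP] := homog_norm_sphere_ge.
exists m^-1 => [|g k gq]; first by rewrite invr_gt0.
have /choice[a aP] (j : 'I_n) : exists a : R, 0 <= a /\ a ^+ wt G j = `|g 0 j|.
  by have [a a0 aE] := nneg_root (normr_ge0 (g 0 j)) (wt_gt0 G j); exists a.
pose l := [arg max_(j > k) a j]%O; pose T := a l.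
have amax j : a j <= T by rewrite /T /l; case: arg_maxP => // j' _; exact.
have T0 : 0 <= T by case: (aP l).
have [TE|TN0] := eqVneq T 0.
  have [ak0 <-] := aP k; rewrite lerXn2r ?nnegrE//; last first.
    by rewrite (le_trans (amax k))// TE mulr_ge0 ?N_ge0// invr_ge0 ltW.
  by rewrite mulr_ge0 ?N_ge0// invr_ge0 ltW.
have Tgt : 0 < T by rewrite lt_def TN0.
have [ak0 <-] := aP k.
rewrite lerXn2r ?nnegrE ?mulr_ge0 ?N_ge0 ?invr_ge0 ?(ltW m0)//.
rewrite (le_trans (amax k))// mulrC ler_pdivlMr// -ler_pdivlMl//.
rewrite -N_dil ?invr_gt0// mP//; first exact: quot_dil.
have dE j : `|dil G T^-1 g 0 j| = (a j / T) ^+ wt G j.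
  have [aj0 ajE] := aP j.
  by rewrite mxE normrM normrX normfV (gtr0_norm Tgt) -ajE exprMn mulrC.
apply/eqP; rewrite eq_le; apply/andP; split.
  apply: row_norm_le => // j; rewrite dE exprn_ile1 ?divr_ge0//; first by case: (aP j).
  by rewrite ler_pdivrMr// mul1r.
by rewrite (le_trans _ (coord_le_norm _ l))// dE divff// expr1n.
Qed.

End homogeneous_norm.

(** * Horizontal lines *)

Section lines.
Variables (R : realType) (n s : nat) (G : carnot R n s).
Implicit Types (u v y z : 'rV[R]_n) (a t e : R) (i : nat).

Lemma step_gt0 : (0 < s)%N.
Proof. by have [k <-] := wt_top G; exact: wt_gt0. Qed.

Lemma dilZ a t v : dil G a (t *: v) = t *: dil G a v.
Proof. by apply/rowP => k; rewrite !mxE mulrCA. Qed.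

Lemma dilK a v : a != 0 -> dil G a (dil G a^-1 v) = v.
Proof.
by move=> a0; apply/rowP => k; rewrite !mxE mulrA -exprMn divff// expr1n mul1r.
Qed.

Lemma dilVK a v : a != 0 -> dil G a^-1 (dil G a v) = v.
Proof. by move=> a0; rewrite -{2}[a]invrK dilK// invr_eq0. Qed.

Lemma dil_layer a v : layer (wt G) 1 v -> layer (wt G) 1 (dil G a v).
Proof. by move=> v1 k k1; rewrite mxE v1// mulr0. Qed.

(* If, for each i, some point of the line {exp(-t v)} matches y up to order e in
   the layer i, then the identity matches y up to order e in all layers. This
   is because the i-th coordinates of exp(t v) y and y differ, for i > 1, by a
   Lipschitz function of (y_1, ..., y_(i-1)) that vanishes at 0. *)
Lemma line_close_layerwise (A : R) : 0 <= A -> exists2 K : R, 0 <= K &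
  forall e y v (tau : nat -> R), 0 <= e <= 1 -> layer (wt G) 1 v ->
    tau 1%N = 0 ->
    (forall i k, (0 < i <= s)%N -> (wt G k < i)%N ->
      `|cmul G (tau i *: v) y 0 k| <= A) ->
    (forall k, `|cmul G (tau (wt G k) *: v) y 0 k| <= A * e) ->
    `|y| <= K * e.
Proof.
move=> A0; suff H (m : nat) : exists2 K : R, 0 <= K &
    forall e y v (tau : nat -> R), 0 <= e <= 1 -> layer (wt G) 1 v ->
    tau 1%N = 0 ->
    (forall i k, (0 < i <= s)%N -> (wt G k < i)%N ->
      `|cmul G (tau i *: v) y 0 k| <= A) ->
    (forall k, `|cmul G (tau (wt G k) *: v) y 0 k| <= A * e) ->
    forall k, (wt G k <= m)%N -> `|y 0 k| <= K * e.
  have [K K0 KP] := H s; exists K => // e y v tau e01 v1 tau1 low top.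
  have /andP[e0 _] := e01.
  apply: row_norm_le => [|k]; first by rewrite mulr_ge0.
  by apply: KP v1 tau1 low top _ _ => //; have /andP[] := wt_bound G k.
elim: m => [|m [Km Km0 IH]].
  by exists 0 => // e y v tau _ _ _ _ _ k; rewrite leqn0 gtn_eqF// wt_gt0.
have [KL KL0 KLP] := cmul_lipschitz G (A + Km).
exists (A + Km + KL * Km); first by rewrite !addr_ge0// mulr_ge0// ltW.
move=> e y v tau e01 v1 tau1 low top k; have /andP[e0 e1] := e01.
have IHy := IH e y v tau e01 v1 tau1 low top.
rewrite leq_eqVlt => /predU1P[km|]; last first.
  rewrite ltnS => /IHy /le_trans; apply; rewrite ler_wpM2r// -addrA [leRHS]addrCA.
  by rewrite lerDl addr_ge0// mulr_ge0// ltW.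
(* In the first layer [tau 1 = 0], so the hypothesis already concerns [y] itself. *)
have [m0|m0] := posnP m.
  have := top k; rewrite km m0 tau1 scale0r cmul0l => /le_trans; apply.
  by rewrite ler_wpM2r// -addrA lerDl addr_ge0// mulr_ge0// ltW.
have ms : (0 < m.+1 <= s)%N by rewrite -km; exact: wt_bound.
have Kme : Km * e <= Km by rewrite ler_piMr.
pose u := tau m.+1 *: v.
(* [u] lives in the first layer, where coordinates add: those of [u] are those of [u . y] minus
   those of [y]. *)
have uM : `|u| <= A + Km.
  apply: row_norm_le => [|j]; first exact: addr_ge0.
  have [j1|j1] := eqVneq (wt G j) 1%N; last first.
    by rewrite mxE v1// mulr0 normr0 addr_ge0.
  have := low m.+1 j ms; rewrite j1 ltnS => /(_ m0).
  rewrite cmul_coord_add => [lowj|l|l]; last 2 first.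
  - by rewrite j1 ltnNge wt_gt0.
  - by rewrite j1 ltnNge wt_gt0.
  rewrite -[u 0 j](addrK (y 0 j)) (le_trans (ler_normB _ _))// lerD//.
  by rewrite (le_trans _ Kme)// IHy// j1.
pose p := cproj G m y.
have pM : `|p| <= Km * e.
  apply: row_norm_le => [|j]; first exact: mulr_ge0.
  by rewrite mxE; case: ifP => [/IHy//|_]; rewrite normr0 mulr_ge0.
have pk : p 0 k = 0 by rewrite mxE km ltnn.
have uk : u 0 k = 0 by rewrite mxE v1 ?mulr0// km eqSS -lt0n.
(* [p] agrees with [y] below the weight of [k], so the nonlinear parts of the two products
   coincide. *)
have yE : y 0 k = cmul G u y 0 k - cmul G u p 0 k.
  have := @cmul_coord_low _ _ _ G k u y u p; rewrite pk uk !subr0 => H.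
  rewrite -H ?subKr// => j; rewrite km ltnS => jm; rewrite mxE jm//.
have wk : `|cmul G u y 0 k| <= A * e by have := top k; rewrite km.
rewrite yE (le_trans (ler_normB _ _))// mulrDl lerD//.
  by rewrite (le_trans wk)// ler_wpM2r// lerDl.
(* [u . 0 = u] has zero [k]-th coordinate, since [k] has weight greater than 1; the Lipschitz bound
   then gives a multiple of [|p|]. *)
have -> : cmul G u p 0 k = (cmul G u p - cmul G u 0) 0 k.
  by rewrite !mxE cmul0r uk subr0.
rewrite (le_trans (coord_le_norm _ _))// (le_trans (KLP _ _ _ _ _ _ _ _))//.
- by rewrite (le_trans pM)// (le_trans Kme)// lerDr.
- by rewrite normr0 addr_ge0.
by rewrite subrr normr0 add0r subr0 -mulrA ler_pM2l.
Qed.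

Lemma horiz_line_dil (x : 'rV[R]_n) a (L : set 'rV[R]_n) : 0 < a -> horiz_line G L ->
  horiz_line G ((fun y => dil G a (cmul G x y)) @` L).
Proof.
move=> a0 [g [v [v1 v0 ->]]]; exists (dil G a (cmul G x g)), (dil G a v); split.
- exact: dil_layer.
- apply: contra v0 => /eqP v0; apply/eqP/rowP => k.
  have /rowP/(_ k) := v0; rewrite !mxE => /eqP.
  by rewrite mulf_eq0 expf_eq0 (gt_eqF a0) andbF => /eqP.
- apply/seteqP; split=> y /=.
    move=> [_ [t ->] <-]; exists t.
    by rewrite cmulA /dil dilation_aut// -dilZ.
  move=> [t ->]; exists (cmul G g (t *: v)); first by exists t.
  by rewrite cmulA /dil dilation_aut// -dilZ.
Qed.

(** The first layer is nonzero: otherwise all brackets with it would vanish, and by the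
    stratification so would every layer, including the top one. *)
Lemma horiz_line_through0 : exists2 L, horiz_line G L & L 0.
Proof.
suff [v v1 v0] : exists2 v : 'rV[R]_n, layer (wt G) 1 v & v != 0.
  exists [set y | exists t, y = cmul G 0 (t *: v)]; first by exists 0, v.
  by exists 0; rewrite scale0r cmul0l.
have [k ks] := wt_top G.
apply: contrapT => V10.
have V1 v : layer (wt G) 1 v -> v = 0.
  by move=> v1; apply/eqP; apply: contraT => v0; exfalso; apply: V10; exists v.
have ek i : wt G k = i -> layer (wt G) i (delta_mx 0 k : 'rV[R]_n).
  move=> ki j ji; rewrite mxE /=; case: eqP => // jk.
  by move: ji; rewrite jk ki eqxx.
have ek0 : (delta_mx 0 k : 'rV[R]_n) <> 0.
  by move=> /rowP/(_ k)/eqP; rewrite !mxE !eqxx oner_eq0.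
have := wt_gt0 G k; case: (wt G k) {ks} (ek) => // -[|i] {}ek _.
  exact/ek0/V1/ek.
have := ek _ erefl; rewrite -(@carnot_strat _ _ _ G i.+1)// => -[m [c [b [bP bE]]]].
apply: ek0; rewrite bE big1// => j _.
have [u [v [/V1 -> _ ->]]] := bP j.
by rewrite /lie_bracket derive0 scaler0.
Qed.

End lines.

(** * Flatness and the Euclidean quantity *)

Section flatness.
Variables (R : realType) (n s : nat) (G : carnot R n s).
Variables (N : nat -> 'rV[R]_n -> R).
Hypothesis hN : forall i, (1 <= i <= s)%N -> homog_norm G i (N i).
Implicit Types (E L : set 'rV[R]_n) (x z : 'rV[R]_n) (r e : R).

(** The common yardstick for the three quantities. Using [a^-1 z] makes it invariant under left
    translations, and the norm is the sup norm. *)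
Definition flat (S L : set 'rV[R]_n) (r e : R) :=
  forall z, S z -> exists2 a, L a & `|dil G r^-1 (cmul G (- a) z)| <= e ^+ s.

Lemma flat_le S L r e e' : 0 <= e <= e' -> flat S L r e -> flat S L r e'.
Proof.
move=> /andP[e0 ee'] fl z /fl[a La az]; exists a => //.
by rewrite (le_trans az)// lerXn2r// nnegrE (le_trans e0).
Qed.

(** [X] agrees up to the factor [K] with the infimum of the [e] for which some line is flat. The
    strict inequality in the last clause allows for infima that are not attained. *)
Definition measures_flatness (X : set 'rV[R]_n -> 'rV[R]_n -> R -> \bar R) (K : R) :=
  forall E x r, 0 < r -> [/\ (0 <= X E x r)%E,
    forall L e, horiz_line G L -> 0 < e -> flat (E `&` hball G N x r) L r e ->
      (X E x r <= (K * e)%:E)%E &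
    forall e, 0 < e -> (X E x r < e%:E)%E ->
      exists2 L, horiz_line G L & flat (E `&` hball G N x r) L r (K * e)].

Lemma measures_flatness_le X Y (KX KY : R) : 0 < KX -> 0 < KY ->
  measures_flatness X KX -> measures_flatness Y KY ->
  forall E x r, 0 < r -> (X E x r <= (KX * KY)%:E * Y E x r)%E.
Proof.
move=> KX0 KY0 hX hY E x r r0.
have K0 : 0 < KX * KY by exact: mulr_gt0.
have [_ Xup _] := hX E x r r0; have [Y0 _ Ylo] := hY E x r r0.
case: (Y E x r) Y0 Ylo => [y| |] // y0 Ylo; last by rewrite gt0_muley ?lte_fin// leey.
rewrite lee_fin in y0; apply/lee_addgt0Pr => d d0.
(* The excess over [y] becomes exactly [d] after multiplication by [KX * KY]. *)
have e0 : 0 < y + d / (KX * KY) by rewrite ltr_wpDl// divr_gt0.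
have [|L Lh Lf] := Ylo _ e0; first by rewrite lte_fin ltrDl divr_gt0.
rewrite (le_trans (Xup L _ Lh _ Lf)) ?mulr_gt0// lee_fin.
by rewrite mulrA mulrDr (mulrC _ (d / _)) divfK// gt_eqF.
Qed.

Lemma homog_norm_top : homog_norm G s (N s).
Proof. by apply: hN; rewrite (step_gt0 G) leqnn. Qed.

Lemma cproj_top g : cproj G s g = g.
Proof. by apply/rowP => k; rewrite mxE; have /andP[_ ->] := wt_bound G k. Qed.

Lemma quot_top g : quot G s g. Proof. by rewrite -[g]cproj_top; exact: quot_cproj. Qed.

Lemma unit_ball_bounded : exists2 M : R, 1 <= M &
  forall z, N s z <= 1 -> `|z| <= M.
Proof.
have [K K0 KP] := homog_norm_coord_le homog_norm_top.
have Ks : 1 <= (1 + K) ^+ s by rewrite exprn_ege1// lerDl ltW.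
exists ((1 + K) ^+ s) => // z z1.
apply: row_norm_le => [|k]; first exact: le_trans Ks.
rewrite (le_trans (KP z k (quot_top z)))//.
have Nz : 0 <= N s z by case: homog_norm_top => + _ _ _ _; apply; exact: quot_top.
apply: (@le_trans _ _ ((1 + K) ^+ wt G k)).
  rewrite lerXn2r ?nnegrE ?mulr_ge0 ?addr_ge0 ?(ltW K0)//.
  by rewrite (@le_trans _ _ K) ?ler_piMr ?(ltW K0)// lerDr.
by rewrite ler_weXn2l ?lerDl ?(ltW K0)//; have /andP[] := wt_bound G k.
Qed.

Lemma hball_unit x r z : 0 < r -> hball G N x r z ->
  N s (dil G r^-1 (cmul G (- x) z)) < 1.
Proof.
move=> r0; rewrite /hball /hdist /qmul /= cproj_top => zr.
have [_ _ Ndil _ _] := homog_norm_top.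
rewrite Ndil ?invr_gt0//; last exact: quot_top.
by rewrite mulrC ltr_pdivrMr// mul1r.
Qed.

(** A line through the centre [x] suffices, because the rescaled ball is bounded. *)
Lemma flat_trivial : exists2 K : R, 1 <= K &
  forall E x r, 0 < r -> exists2 L, horiz_line G L & flat (E `&` hball G N x r) L r K.
Proof.
have [M M1 MP] := unit_ball_bounded; exists M => // E x r r0.
have [L Lh L0] := horiz_line_through0 G.
exists ((fun y => dil G 1 (cmul G x y)) @` L); first exact: horiz_line_dil.
have -> : (fun y => dil G 1 (cmul G x y)) = cmul G x.
  by apply/funext => y; apply/rowP => k; rewrite mxE expr1n mul1r.
move=> z [_ /hball_unit zr]; exists x; first by exists 0 => //; rewrite cmul0r.
rewrite (le_trans (MP _ (ltW (zr r0))))//.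
by rewrite ler_eXnr// (step_gt0 G).
Qed.

(** Thanks to the trivial line, the upper bound matters only for bounded [e] and the lower bound
    only for small [e]. *)
Lemma measures_flatness_intro (X : set 'rV[R]_n -> 'rV[R]_n -> R -> \bar R) :
  (forall E x r, (0 <= X E x r)%E) ->
  (forall M, exists2 K : R, 0 < K & forall E x r L e, 0 < r -> horiz_line G L ->
    0 < e <= M -> flat (E `&` hball G N x r) L r e -> (X E x r <= (K * e)%:E)%E) ->
  (exists e0, exists K : R, [/\ 0 < e0, 0 < K & forall E x r e, 0 < r ->
    0 < e < e0 -> (X E x r < e%:E)%E ->
    exists2 L, horiz_line G L & flat (E `&` hball G N x r) L r (K * e)]) ->
  exists2 K : R, 0 < K & measures_flatness X K.
Proof.
move=> X0 Xup [e0 [Klo [e00 Klo0 Xlo]]].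
have [K0 K01 K0P] := flat_trivial.
have K00 : 0 < K0 by exact: lt_le_trans K01.
have [Kup Kup0 KupP] := Xup K0.
have K0e0 : 0 < K0 / e0 by exact: divr_gt0.
(* The last summand makes the constant times [e] exceed [K0] once [e >= e0], so that the trivial
   line applies. *)
exists (Kup + Klo + K0 / e0) => [|E x r r0]; first by rewrite !addr_gt0.
split=> // [L e Lh e_gt0 Lf|e e_gt0 Xe].
  have XK : (X E x r <= (Kup * e)%:E)%E.
    have [eK|Ke] := leP e K0; first by apply: KupP Lh _ Lf => //; rewrite e_gt0.
    have [L' L'h L'f] := K0P E x r r0.
    apply: (@le_trans _ _ (Kup * K0)%:E).
      by apply: KupP L'h _ L'f => //; rewrite K00 lexx.
    by rewrite lee_fin ler_pM2l// ltW.
  rewrite (le_trans XK)// lee_fin ler_pM2r// -addrA lerDl ltW// addr_gt0//.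
have [ee0|e0e] := ltP e e0.
  have [|L Lh Lf] := Xlo E x r e r0 _ Xe; first by rewrite e_gt0.
  exists L => //; apply: flat_le Lf; rewrite mulr_ge0 ?ltW//= ltr_pM2r//.
  by rewrite addrAC ltrDr addr_gt0.
have [L Lh Lf] := K0P E x r r0; exists L => //; apply: flat_le Lf.
rewrite (ltW K00)/= -ler_pdivrMr// (@le_trans _ _ (K0 / e0))//.
  by rewrite ler_pM2l// lef_pV2.
by rewrite lerDr addr_ge0// ltW.
Qed.

Lemma euc_norm_le c (g : 'rV[R]_n) : 0 < c -> euc_norm c g <= c * n%:R * `|g|.
Proof.
move=> c0; rewrite /euc_norm -mulrA ler_pM2l// -[leRHS]ger0_norm ?mulr_ge0//.
rewrite -sqrtr_sqr ler_wsqrtr// exprMn.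
apply: (@le_trans _ _ (n%:R * `|g| ^+ 2)).
  have -> : n%:R * `|g| ^+ 2 = \sum_(k < n) `|g| ^+ 2.
    by rewrite sumr_const card_ord mulr_natl.
  rewrite ler_sum// => k _.
  by rewrite -real_normK ?num_real// lerXn2r ?nnegrE// coord_le_norm.
rewrite ler_wpM2r ?exprn_ge0// -natrX ler_nat.
by case: (n) => // m; rewrite leq_pmulr.
Qed.

Lemma euc_norm_ge c (g : 'rV[R]_n) : 0 < c -> c * `|g| <= euc_norm c g.
Proof.
move=> c0; rewrite ler_pM2l//; apply: row_norm_le => [|k]; first exact: sqrtr_ge0.
by rewrite -sqrtr_sqr ler_wsqrtr// (bigD1 k)//= lerDl sumr_ge0// => j _; exact: sqr_ge0.
Qed.

Lemma euc_flatness_measures c : 0 < c -> exists2 K : R, 0 < K &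
  measures_flatness (euc_flatness G N c) K.
Proof.
move=> c0; apply: measures_flatness_intro => [E x r|M|].
- apply: le_ereal_inf_tmp => _ [L _ <-].
  by apply: le_ereal_inf_tmp => _ [e [e0 _] <-]; rewrite lee_fin ltW.
- have cn0 : 0 < c * n%:R + 1 by rewrite ltr_wpDl// mulr_ge0// ltW.
  (* The added 1 gives the strict inequality demanded by the open Euclidean ball. *)
  exists (c * n%:R + 1) => // E x r L e r0 Lh /andP[e0 _] Lf.
  apply: ge_ereal_inf; eexists; first by exists L.
  apply: ge_ereal_inf; exists ((c * n%:R + 1) * e)%:E => //.
  exists ((c * n%:R + 1) * e) => //; split; first exact: mulr_gt0.
  move=> z /Lf[a La az]; exists a, (cmul G (- a) z); split; [by []| |by rewrite cmulKV].
  exists (dil G r^-1 (cmul G (- a) z)); last by rewrite dilK// gt_eqF.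
  rewrite /euc_ball /= (le_lt_trans (euc_norm_le _ c0))// exprMn.
  apply: (@le_lt_trans _ _ (c * n%:R * e ^+ s)).
    by rewrite ler_wpM2l// mulr_ge0// ltW.
  rewrite ltr_pM2r ?exprn_gt0//.
  apply: (@lt_le_trans _ _ (c * n%:R + 1)); first by rewrite ltrDl.
  by rewrite ler_eXnr ?(step_gt0 G)// lerDr mulr_ge0// ltW.
(* [1 + c^-1] is at least 1, so its [s]-th power still dominates the factor [c^-1]. *)
- exists 1, (1 + c^-1); rewrite ltr01 addr_gt0 ?invr_gt0//; split=> //.
  move=> E x r e r0 /andP[e0 _] /ereal_inf_lt[_ [L Lh <-]].
  move=> /ereal_inf_lt[_ [d [d0 dP] <-]]; rewrite lte_fin => de.
  exists L => // z /dP[a [_ [La [b bd <-] ->]]]; exists a => //.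
  rewrite cmulVK dilVK ?gt_eqF//.
  have := le_lt_trans (euc_norm_ge _ c0) bd.
  rewrite mulrC -ltr_pdivlMr// => /ltW /le_trans; apply.
  rewrite exprMn mulrC ler_pM ?invr_ge0 ?exprn_ge0 ?(ltW c0) ?(ltW d0)//.
    apply: (@le_trans _ _ (1 + c^-1)); first by rewrite lerDr.
    by rewrite ler_eXnr ?(step_gt0 G)// lerDl invr_ge0 ltW.
  by rewrite lerXn2r ?nnegrE ?(ltW d0) ?(ltW e0) ?(ltW de).
Qed.
End flatness.

(** * Stratified beta-numbers *)

Lemma esup_on_ge0 (R : realType) (T : Type) (A : set T) (f : T -> R) :
  (0 <= esup_on A f)%E.
Proof. by apply: ereal_sup_ubound; left. Qed.

Lemma esup_on_ge (R : realType) (T : Type) (A : set T) (f : T -> R) z :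
  A z -> ((f z)%:E <= esup_on A f)%E.
Proof. by move=> Az; apply: ereal_sup_ubound; right; exists z. Qed.

Lemma esup_on_le (R : realType) (T : Type) (A : set T) (f : T -> R) (y : R) :
  0 <= y -> (forall z, A z -> f z <= y) -> (esup_on A f <= y%:E)%E.
Proof.
by move=> y0 fy; apply: ge_ereal_sup => _ [->|[z Az <-]]; rewrite lee_fin// fy.
Qed.

Lemma dist_set_le (R : realType) (n : nat) (d : 'rV[R]_n -> 'rV[R]_n -> R)
    z (A : set 'rV[R]_n) a :
  (forall a, A a -> 0 <= d z a) -> A a -> dist_set d z A <= d z a.
Proof.
move=> d0 Aa; apply: ge_inf; last by exists a.
by exists 0 => _ [b Ab <-]; exact: d0.
Qed.

Lemma dist_set_ge0 (R : realType) (n : nat) (d : 'rV[R]_n -> 'rV[R]_n -> R)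
    z (A : set 'rV[R]_n) :
  (forall a, A a -> 0 <= d z a) -> 0 <= dist_set d z A.
Proof.
move=> d0; have [[a Aa]|A0] := pselect (A !=set0).
  by apply: lb_le_inf => [|_ [b Ab <-]]; [exists (d z a), a|exact: d0].
rewrite /dist_set (_ : [set d z a | a in A] = set0) ?inf0//.
by apply/seteqP; split=> // y [a Aa _]; apply: A0; exists a.
Qed.

Lemma dist_set_lt (R : realType) (n : nat) (d : 'rV[R]_n -> 'rV[R]_n -> R)
    z (A : set 'rV[R]_n) (t : R) :
  A !=set0 -> dist_set d z A < t -> exists2 a, A a & d z a < t.
Proof.
move=> [a Aa] /inf_lt; case; first by exists (d z a), a.
by move=> _ [b Ab <-] bt; exists b.
Qed.

Section beta.
Variables (R : realType) (n s : nat) (G : carnot R n s).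
Variables (N : nat -> 'rV[R]_n -> R).
Hypothesis hN : forall i, (1 <= i <= s)%N -> homog_norm G i (N i).
Implicit Types (E L : set 'rV[R]_n) (x z : 'rV[R]_n) (r e : R).

(** Symmetry of the norm turns [z^-1 a] into [a^-1 z], and homogeneity extracts [r]. *)
Lemma hdist_cproj i r z a : (1 <= i <= s)%N -> 0 < r ->
  hdist G N i (cproj G i z) (cproj G i a) =
  r * N i (cproj G i (dil G r^-1 (cmul G (- a) z))).
Proof.
move=> /hN[_ Nopp Ndil _ _] r0; have qp g := quot_cproj G i g.
rewrite cproj_dil Ndil ?invr_gt0// mulVKf ?gt_eqF// -Nopp// /cinv -cprojN.
by rewrite cmul_oppr opprK /hdist /qmul /cinv -cprojN -cproj_cmul.
Qed.

Let hdist_ge0 i z a : (1 <= i <= s)%N -> 0 <= hdist G N i z a.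
Proof. by move=> /hN[N0 _ _ _ _]; apply: N0; exact: quot_cproj. Qed.

Lemma poweR_root (e : R) (m : nat) : 0 <= e -> (0 < m)%N ->
  ((e ^+ m)%:E `^ (m%:R^-1) = e%:E)%E.
Proof.
move=> e0 m0; rewrite poweR_EFin -powR_mulrn// -powRrM mulfV ?powRr1//.
by rewrite pnatr_eq0 -lt0n.
Qed.

Let s2_gt0 : (0 < 2 * s)%N. Proof. by rewrite muln_gt0 (step_gt0 G). Qed.

(** Only weights up to [i] occur in the [i]-th quotient, so the distance there is of order
    [e^(s/i)], and every summand is of order [e^(2s)]. *)
Lemma strat_beta_le_flat (M : R) : exists2 K : R, 0 < K &
  forall E x r L e, 0 < r -> horiz_line G L -> 0 < e <= M ->
    flat G (E `&` hball G N x r) L r e -> (strat_beta G N E x r <= (K * e)%:E)%E.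
Proof.
wlog M1 : M / 1 <= M.
  move=> H; have [|K K0 KP] := H (1 + `|M|); first by rewrite lerDl.
  exists K => // E x r L e r0 Lh /andP[e0 eM]; apply: KP => //; rewrite e0 /=.
  by rewrite (le_trans eM)// (le_trans (ler_norm _))// lerDr.
have M0 : 0 < M by exact: lt_le_trans M1.
have /choice[K KP] : forall i, exists K : R, (1 <= i <= s)%N -> 0 < K /\
    forall g t, quot G i g -> 0 <= t -> (forall k, `|g 0 k| <= t ^+ wt G k) ->
      N i g <= K * t.
  move=> i; have [is_|_] := boolP (1 <= i <= s)%N; last by exists 0.
  by have [K K0 KP] := homog_norm_le (hN is_); exists K.
pose B := \sum_(1 <= i < s.+1) (K i * M ^+ s) ^+ (2 * i).
have B0 : 0 <= B.
  rewrite /B big_nat sumr_ge0// => i /KP[Ki _].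
  by rewrite exprn_ge0// mulr_ge0 ?exprn_ge0// ltW.
exists (1 + B) => [|E x r L e r0 Lh /andP[e0 eM] Lf]; first by rewrite ltr_pwDl.
(* Normalizing to [h <= 1] makes the root [t = h^(s/i)] at most 1, so [t ^+ i <= t ^+ wt G k] in
   weights up to [i]. *)
pose h := e / M.
have h0 : 0 < h by exact: divr_gt0.
have h1 : h <= 1 by rewrite ler_pdivrMr// mul1r.
have he : h <= e by rewrite ler_pdivrMr// ler_pMr.
have eE : e = M * h by rewrite mulrC divfK// gt_eqF.
clearbody h.
have termP i : (1 <= i < s.+1)%N ->
    (esup_on (E `&` hball G N x r) (fun z =>
       ((dist_set (hdist G N i) (cproj G i z) (cproj G i @` L) / r) ^+ (2 * i))%R)
     <= ((K i * M ^+ s) ^+ (2 * i) * h ^+ (2 * s))%:E)%E.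
  rewrite ltnS => is_; have /andP[i0 i_s] := is_; have [Ki0 KiP] := KP i is_.
  have KM0 : 0 <= K i * M ^+ s by rewrite mulr_ge0 ?exprn_ge0// ltW.
  apply: esup_on_le => [|z /Lf[a La az]].
    by rewrite mulr_ge0 ?exprn_ge0// ltW.
  have [t t0 ti] := nneg_root (exprn_ge0 s (ltW h0)) i0.
  have t1 : t <= 1.
    by rewrite -(@ler_pXn2r _ i)// ?nnegrE// ti expr1n exprn_ile1// ltW.
  pose w := dil G r^-1 (cmul G (- a) z).
  have Nw : N i (cproj G i w) <= K i * (M ^+ s * t).
    apply: KiP => [||k]; first exact: quot_cproj.
      by rewrite mulr_ge0// exprn_ge0// ltW.
    rewrite mxE; case: ifP => [ki|_]; last first.
      by rewrite normr0 exprn_ge0// mulr_ge0// exprn_ge0// ltW.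
    rewrite (le_trans (coord_le_norm _ _))// (le_trans az)//.
    rewrite eE !exprMn ler_pM ?exprn_ge0 ?(ltW M0) ?(ltW h0)//.
      by rewrite ler_eXnr ?exprn_ege1// wt_gt0.
    by rewrite -ti ler_wiXn2l.
  have dr : dist_set (hdist G N i) (cproj G i z) (cproj G i @` L) / r <=
      K i * M ^+ s * t.
    rewrite ler_pdivrMr// -mulrA mulrC; apply: le_trans (ler_wpM2l (ltW r0) Nw).
    rewrite -hdist_cproj//; apply: dist_set_le => [b _|]; first exact: hdist_ge0.
    by exists a.
  rewrite (_ : h ^+ (2 * s) = t ^+ (2 * i)).
    rewrite -exprMn lerXn2r ?nnegrE ?(mulr_ge0 KM0)//.
    rewrite divr_ge0 ?(ltW r0)//.
    by apply: dist_set_ge0 => b _; exact: hdist_ge0.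
  by rewrite mulnC exprM -ti -exprM mulnC.
have bound : (ereal_inf
      [set (\sum_(1 <= i < s.+1)
              esup_on (E `&` hball G N x r)
                (fun z => ((dist_set (hdist G N i) (cproj G i z)
                              (cproj G i @` L) / r) ^+ (2 * i))%R))%E
       | L in horiz_line G] <= (((1 + B) * h) ^+ (2 * s))%:E)%E.
  apply: ge_ereal_inf; eexists; first by exists L.
  rewrite big_nat; apply: (le_trans (lee_sum _ termP)).
  rewrite sumEFin lee_fin -mulr_suml -big_nat -/B exprMn ler_wpM2r ?exprn_ge0 ?(ltW h0)//.
  by rewrite (@le_trans _ _ (1 + B)) ?lerDr// ler_eXnr// lerDl.
have inf_ge0 : (0 <= ereal_inf
      [set (\sum_(1 <= i < s.+1)
              esup_on (E `&` hball G N x r)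
                (fun z => ((dist_set (hdist G N i) (cproj G i z)
                              (cproj G i @` L) / r) ^+ (2 * i))%R))%E
       | L in horiz_line G])%E.
  apply: le_ereal_inf_tmp => _ [L' _ <-]; apply: sume_ge0 => i _.
  exact: esup_on_ge0.
have Bh0 : 0 <= (1 + B) * h by rewrite mulr_ge0 ?addr_ge0// ltW.
have root0 : 0 <= ((2 * s)%:R : R)^-1 by rewrite invr_ge0.
apply: le_trans (gt0_ler_poweR root0 _ _ bound) _.
- by rewrite in_itv/= inf_ge0 leey.
- by rewrite in_itv/= lee_fin exprn_ge0// leey.
rewrite poweR_root// lee_fin ler_wpM2l ?addr_ge0//.
Qed.

(** The [i]-th summand yields a point of the line that matches [z] to order [e^s] in layer [i] and
    boundedly in lower layers. [line_close_layerwise] then shows that the point for [i = 1] serves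
    all layers. *)
Lemma flat_of_strat_beta_lt : exists2 K : R, 0 < K & forall E x r e, 0 < r ->
    0 < e < 1 -> (strat_beta G N E x r < e%:E)%E ->
    exists2 L, horiz_line G L & flat G (E `&` hball G N x r) L r (K * e).
Proof.
have /choice[K KP] : forall i, exists K : R, 0 <= K /\ ((1 <= i <= s)%N ->
    forall g k, quot G i g -> `|g 0 k| <= (K * N i g) ^+ wt G k).
  move=> i; have [is_|_] := boolP (1 <= i <= s)%N; last by exists 0.
  by have [K K0 KP] := homog_norm_coord_le (hN is_); exists K; rewrite ltW.
(* One bound for all the powers [K i ^+ wt G k], as weights are at most [s]. *)
pose A := \sum_(1 <= i < s.+1) (1 + K i) ^+ s.
have Kge0 i : 0 <= (1 + K i) ^+ s by rewrite exprn_ge0// addr_ge0//; case: (KP i).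
have A0 : 0 <= A by rewrite sumr_ge0.
have KA i k : (1 <= i <= s)%N -> K i ^+ wt G k <= A.
  move=> is_; have [Ki0 _] := KP i.
  apply: (@le_trans _ _ ((1 + K i) ^+ s)).
    apply: (@le_trans _ _ ((1 + K i) ^+ wt G k)).
      by rewrite lerXn2r ?nnegrE ?addr_ge0// lerDr.
    by rewrite ler_weXn2l ?lerDl//; have /andP[] := wt_bound G k.
  rewrite /A (bigD1_seq i) ?iota_uniq ?mem_index_iota//=.
  by rewrite lerDl sumr_ge0.
have [C C0 CP] := line_close_layerwise G A0.
exists (1 + C) => [|E x r e r0 /andP[e0 e1] be]; first by rewrite ltr_pwDl.
have [L Lh Lsum] : exists2 L, horiz_line G L & (\sum_(1 <= i < s.+1)
    esup_on (E `&` hball G N x r) (fun z => ((dist_set (hdist G N i)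
      (cproj G i z) (cproj G i @` L) / r) ^+ (2 * i))%R) < (e ^+ (2 * s))%:E)%E.
  suff /ereal_inf_lt[_ [L Lh <-] LP] : (ereal_inf
      [set (\sum_(1 <= i < s.+1)
              esup_on (E `&` hball G N x r)
                (fun z => ((dist_set (hdist G N i) (cproj G i z)
                              (cproj G i @` L) / r) ^+ (2 * i))%R))%E
       | L in horiz_line G] < (e ^+ (2 * s))%:E)%E by exists L.
  (* Were the infimum at least [e ^+ (2 * s)], its root would be at least [e]. *)
  rewrite ltNge; apply: contraTN be => ei; rewrite -leNgt.
  rewrite -(poweR_root (ltW e0) s2_gt0); apply: gt0_ler_poweR => //.
    by rewrite in_itv/= lee_fin exprn_ge0 ?(ltW e0)// leey.
  rewrite in_itv/= leey andbT; apply: le_trans ei.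
  by rewrite lee_fin exprn_ge0// ltW.
exists L => // z Sz; have [g [v [v1 v0 LE]]] := Lh.
have es0 : 0 < e ^+ s by exact: exprn_gt0.
have tP i : (1 <= i <= s)%N -> exists t : R,
    forall k, (wt G k <= i)%N ->
    `|dil G r^-1 (cmul G (- cmul G g (t *: v)) z) 0 k| <=
       if wt G k == i then A * e ^+ s else A.
  move=> is_; have /andP[i0 i_s] := is_; have [Ki0 KiP] := KP i.
  have [t t0 ti] := nneg_root (ltW es0) i0.
  have t1 : t <= 1.
    by rewrite -(@ler_pXn2r _ i)// ?nnegrE// ti expr1n exprn_ile1// ltW.
  set D := dist_set (hdist G N i) (cproj G i z) (cproj G i @` L).
  have D0 : 0 <= D / r.
    by rewrite divr_ge0 ?(ltW r0)//; apply: dist_set_ge0 => b _; exact: hdist_ge0.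
  have Dt : D / r < t.
    rewrite -(@ltr_pXn2r _ (2 * i)) ?nnegrE ?muln_gt0// -lte_fin.
    have -> : t ^+ (2 * i) = e ^+ (2 * s) by rewrite mulnC exprM ti -exprM mulnC.
    apply: le_lt_trans Lsum.
    rewrite (bigD1_seq i) ?iota_uniq ?mem_index_iota//=.
    apply: (@le_trans _ _ (esup_on (E `&` hball G N x r) (fun z =>
      ((dist_set (hdist G N i) (cproj G i z) (cproj G i @` L) / r) ^+ (2 * i))%R))).
      exact: (esup_on_ge (fun z => (dist_set (hdist G N i)
        (cproj G i z) (cproj G i @` L) / r) ^+ (2 * i)) Sz).
    by rewrite leeDl//; apply: sume_ge0 => j _; exact: esup_on_ge0.
  move: Dt; rewrite ltr_pdivrMr// => /dist_set_lt[|_ [a La <-]].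
    by exists (cproj G i (cmul G g (0 *: v))); exists (cmul G g (0 *: v)) => //;
      rewrite LE; exists 0.
  rewrite (hdist_cproj _ _ is_ r0) mulrC ltr_pM2r// => Nt.
  move: La; rewrite LE => -[u aE]; exists u => k ki; rewrite -aE.
  set w := dil _ _ _; have := KiP is_ (cproj G i w) k (quot_cproj _ _ _).
  rewrite {1}/cproj mxE ki => /le_trans; apply.
  have Nw : 0 <= N i (cproj G i w).
    by have [N0 _ _ _ _] := hN is_; apply: N0; exact: quot_cproj.
  apply: (@le_trans _ _ ((K i * t) ^+ wt G k)).
    by rewrite lerXn2r ?nnegrE ?mulr_ge0// ler_wpM2l// ltW.
  rewrite exprMn; case: eqP => [kE|_].
    by rewrite ler_pM ?exprn_ge0 ?KA// kE ti.
  by rewrite (@le_trans _ _ (K i ^+ wt G k)) ?KA// ler_piMr ?exprn_ge0// exprn_ile1.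
have /choice[t tauP] : forall i, exists t : R, (1 <= i <= s)%N ->
    forall k, (wt G k <= i)%N ->
    `|dil G r^-1 (cmul G (- cmul G g (t *: v)) z) 0 k| <=
       if wt G k == i then A * e ^+ s else A.
  move=> i; have [/tP[t tE]|_] := boolP (1 <= i <= s)%N; last by exists 0.
  by exists t.
exists (cmul G g (t 1%N *: v)); first by rewrite LE; exists (t 1%N).
pose y := dil G r^-1 (cmul G (- cmul G g (t 1%N *: v)) z).
(* Two points of the line differ by a one-parameter subgroup element, so changing the base point
   multiplies [y] on the left by it; its parameter vanishes for [i = 1]. *)
have wE i : cmul G ((t 1%N - t i) *: dil G r^-1 v) y =
    dil G r^-1 (cmul G (- cmul G g (t i *: v)) z).
  rewrite -dilZ /y /dil -dilation_aut ?invr_gt0//; congr dilation.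
  rewrite !cmul_oppr !cmulA; congr (cmul G (cmul G _ _) z).
  by rewrite -!scaleNr cmul_exp addrAC subrr add0r.
apply: (@le_trans _ _ (C * e ^+ s)).
  apply: (CP (e ^+ s) y (dil G r^-1 v) (fun i => t 1%N - t i)).
  - by rewrite (ltW es0) exprn_ile1// ltW.
  - exact: dil_layer.
  - by rewrite subrr.
  - move=> i k is_ ki; rewrite wE; have := tauP i is_ k (ltnW ki).
    by rewrite ltn_eqF.
  - move=> k; rewrite wE; have := tauP (wt G k) (wt_bound G k) k (leqnn _).
    by rewrite eqxx.
rewrite exprMn ler_wpM2r ?(ltW es0)//.
by rewrite (@le_trans _ _ (1 + C)) ?lerDr// ler_eXnr ?(step_gt0 G)// lerDl.
Qed.

Lemma strat_beta_measures : exists2 K : R, 0 < K &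
  measures_flatness G N (strat_beta G N) K.
Proof.
apply: measures_flatness_intro hN _ _ strat_beta_le_flat _.
  by move=> E x r; exact: poweR_ge0.
by have [K K0 KP] := flat_of_strat_beta_lt; exists 1, K.
Qed.

End beta.

(** * Local comparison of Riemannian and Euclidean distances *)

Section riemannian.
Variables (R : realType) (n : nat) (Q : 'rV[R]_n -> 'M[R]_n).
Hypothesis Qcont : forall i j, continuous (fun p => Q p i j).
Hypothesis Qpos : forall p (v : 'rV[R]_n), v != 0 -> 0 < (v *m Q p *m v^T) 0 0.
Implicit Types (p v x y : 'rV[R]_n) (c : R -> 'rV[R]_n).

Let q p v : R := (v *m Q p *m v^T) 0 0.

Let qE p v : q p v = \sum_j \sum_i v 0 i * Q p i j * v 0 j.
Proof.
rewrite /q mxE; apply: eq_bigr => j _; rewrite !mxE mulr_suml.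
by apply: eq_bigr => i _.
Qed.

Let q_ge0 p v : 0 <= q p v.
Proof.
have [->|v0] := eqVneq v 0; first by rewrite /q mul0mx mul0mx mxE.
exact/ltW/Qpos.
Qed.

Let q_continuous : continuous (fun pv : 'rV[R]_n * 'rV[R]_n => q pv.1 pv.2).
Proof.
have -> : (fun pv : 'rV[R]_n * 'rV[R]_n => q pv.1 pv.2) =
    (fun pv => \sum_j \sum_i pv.2 0 i * Q pv.1 i j * pv.2 0 j).
  by apply/funext => pv; exact: qE.
have c2 i : continuous (fun pv : 'rV[R]_n * 'rV[R]_n => pv.2 0 i).
  move=> pv; apply: (@continuous_comp _ _ _ snd (fun v : 'rV[R]_n => v 0 i)).
    exact: cvg_snd.
  exact: coord_continuous.
apply: (continuous_big add_continuous) => j _.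
apply: (continuous_big add_continuous) => i _ pv.
apply: cvgM; last exact: c2.
apply: cvgM; first exact: c2.
by apply: (@continuous_comp _ _ _ fst (fun p => Q p i j)); [exact: cvg_fst|exact: Qcont].
Qed.

Lemma metric_le (M : R) : exists2 K : R, 0 < K &
  forall p v, `|p| <= M -> Num.sqrt (q p v) <= K * `|v|.
Proof.
have /choice[K KP] : forall ij : 'I_n * 'I_n, exists K : R, 0 < K /\
    forall p, `|p| <= M -> `|Q p ij.1 ij.2| <= K.
  move=> [i j]; have [K K0 KP] := continuous_sup_ball_bounded M (Qcont (i := i) (j := j)).
  by exists K.
(* Since [S >= 1], the bound [S * |v| ^+ 2] on the quadratic form is at most the square of
   [S * |v|]. *)
pose S := 1 + \sum_j \sum_i K (i, j).
have S1 : 1 <= S.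
  rewrite lerDl sumr_ge0// => j _; rewrite sumr_ge0// => i _.
  by have [/ltW] := KP (i, j).
have S0 : 0 < S by exact: lt_le_trans S1.
exists S => // p v pM.
rewrite -[leRHS]ger0_norm ?mulr_ge0 ?(ltW S0)// -sqrtr_sqr ler_wsqrtr//.
apply: (@le_trans _ _ (S * `|v| ^+ 2)); last first.
  by rewrite exprMn ler_wpM2r// ler_eXnr.
rewrite qE /S mulrDl mul1r mulr_suml.
apply: (@le_trans _ _ (\sum_j (\sum_i K (i, j)) * `|v| ^+ 2)); last first.
  by rewrite lerDr exprn_ge0.
apply: ler_sum => j _; rewrite mulr_suml; apply: ler_sum => i _.
rewrite (le_trans (ler_norm _))// !normrM expr2 mulrAC [leRHS]mulrC.
have [K0 /(_ _ pM) KQ] := KP (i, j).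
by rewrite ler_pM ?mulr_ge0// ler_pM// coord_le_norm.
Qed.

(** The quadratic form has a positive minimum over the compact product of a ball and the unit
    sphere; scaling [v] does the rest. *)
Lemma metric_ge (M : R) : exists2 k : R, 0 < k &
  forall p v, `|p| <= M -> k * `|v| <= Num.sqrt (q p v).
Proof.
pose A : set ('rV[R]_n * 'rV[R]_n) :=
  [set p | `|p| <= M] `*` [set v : 'rV[R]_n | `|v| = 1].
have cA : compact A.
  apply: compact_setX; first exact: compact_sup_ball.
  apply: (subclosed_compact _ (@compact_sup_ball R n 1)); last by move=> v /= ->.
  apply: (@preimage_closed _ _ (fun g : 'rV[R]_n => `|g|) [set x | x = 1]).
    by move=> g _; exact: norm_continuous.
  exact: closed_eq.
have [A0|A0] := pselect (A !=set0); last first.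
  exists 1 => // p v pM; have [->|v0] := eqVneq v 0.
    by rewrite normr0 mulr0 sqrtr_ge0.
  exfalso; apply: A0; exists (p, `|v|^-1 *: v); split=> //=.
  by rewrite normrZ normfV normr_id mulVf// normr_eq0.
have [[p0 v0]] := compact_EVT_min A0 cA (continuous_subspaceT q_continuous).
rewrite inE => -[/= p0M v01] qmin.
have q00 : 0 < q p0 v0.
  by apply: Qpos; rewrite -normr_eq0 v01 oner_eq0.
exists (Num.sqrt (q p0 v0)) => [|p v pM]; first by rewrite sqrtr_gt0.
have [->|v_neq0] := eqVneq v 0; first by rewrite normr0 mulr0 sqrtr_ge0.
have nv : 0 < `|v| by rewrite normr_gt0.
have := qmin (p, `|v|^-1 *: v); rewrite inE /A /= => /(_ _)/wrap[].
  by split=> //=; rewrite normrZ normfV normr_id mulVf// gt_eqF.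
have -> : q p (`|v|^-1 *: v) = `|v| ^- 2 * q p v.
  rewrite /q linearZ /= -!scalemxAl -scalemxAr !mxE mulrA.
  by rewrite -expr2 exprVn.
rewrite mulrC ler_pdivlMr ?exprn_gt0// => qv.
rewrite -[X in _ * X]ger0_norm// -sqrtr_sqr -sqrtrM ?q_ge0//.
exact: ler_wsqrtr.
Qed.

Let speed c t := Num.sqrt (q (c t) (derive1 c t)).

Let speed_continuous c : C1_curve c -> continuous (speed c).
Proof.
move=> [dc cc] t.
have cont_c : continuous c.
  by move=> u; apply/differentiable_continuous/derivable1_diffP.
have cpair : (fun u => (c u, derive1 c u)) @ t --> (c t, derive1 c t).
  exact: (cvg_pair (cont_c t) (cc t)).
apply: (@continuous_comp _ _ _ (fun u => q (c u) (derive1 c u)) (@Num.sqrt R));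
  last exact: sqrt_continuous.
by apply: (continuous_comp (f := fun u => (c u, derive1 c u))
  (g := fun pv => q pv.1 pv.2) cpair); exact: q_continuous.
Qed.

Let integrable_itv (f : R -> R) a b : continuous f ->
  lebesgue_measure.-integrable `[a, b] (EFin \o f).
Proof.
move=> cf; apply: continuous_compact_integrable; first exact: segment_compact.
exact: continuous_subspaceT.
Qed.

Let Rintegral_cst_itv01 (k : R) :
  \int[lebesgue_measure]_(t in `[0, 1]) (fun=> k : R) t = k.
Proof.
rewrite Rintegral_cst//= lebesgue_measure_itv/= lte_fin ltr01.
by rewrite sube0 mulr1.
Qed.

Let is_derive_segment x v (t : R) : is_derive t (1 : R) (fun t : R => x + t *: v) v.
Proof.
have E : (fun h : R => h^-1 *: (((fun t : R => x + t *: v) \o shift t)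
           (h *: (1 : R)) - (x + t *: v))) @ 0^' --> v.
  apply: cvg_near_cst; near=> h.
  rewrite /= [h *: _]mulr1 opprD addrACA subrr add0r -scalerBl addrK scalerA.
  by rewrite mulVf ?scale1r//; near: h; exact: nbhs_dnbhs_neq.
apply: DeriveDef; first by apply/cvg_ex; exists v.
exact/cvg_lim.
Unshelve. all: by end_near. Qed.

Let C1_segment x v : C1_curve (fun t : R => x + t *: v).
Proof.
split=> [t|]; first by case: (is_derive_segment x v t).
have -> : derive1 (fun t : R => x + t *: v) = cst v.
  by apply/funext => t; rewrite derive1E; case: (is_derive_segment x v t).
by move=> t; exact: cvg_cst.
Qed.

Let curves x y : set R := [set riem_length Q c | c in
  [set c | [/\ C1_curve c, c 0 = x & c 1 = y]]].

Let curves_segment x y : curves x y (riem_length Q (fun t : R => x + t *: (y - x))).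
Proof.
exists (fun t : R => x + t *: (y - x)) => //; split; first exact: C1_segment.
  by rewrite scale0r addr0.
by rewrite scale1r subrKC.
Qed.

Let curves_ge0 x y : lbound (curves x y) 0.
Proof. by move=> _ [c _ <-]; apply: Rintegral_ge0 => t _; exact: sqrtr_ge0. Qed.

Lemma riem_dist_ge0 x y : 0 <= riem_dist Q x y.
Proof.
apply: lb_le_inf; last exact: curves_ge0.
by eexists; exact: curves_segment.
Qed.

(** The straight segment is an admissible curve and stays in the ball of radius [3 * M], where the
    metric is bounded. *)
Lemma riem_dist_le (M : R) : exists2 K : R, 0 < K &
  forall x y, `|x| <= M -> `|y| <= M -> riem_dist Q x y <= K * `|x - y|.
Proof.
have [K K0 KP] := metric_le (3 * M); exists K => // x y xM yM.
have M0 : 0 <= M by exact: le_trans xM.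
apply: le_trans (ge_inf _ (curves_segment x y)) _.
  by exists 0; exact: curves_ge0.
rewrite -[leRHS]Rintegral_cst_itv01; apply: le_Rintegral => //.
- exact: integrable_itv (speed_continuous (C1_segment _ _)).
- by apply: integrable_itv => t; exact: cvg_cst.
move=> t /=; rewrite in_itv /= => /andP[t0 t1].
rewrite derive1E; have [_ ->] := is_derive_segment x (y - x) t.
rewrite (distrC x); apply: KP.
rewrite (le_trans (ler_normD _ _))// (_ : 3 * M = M + 1 * (M + M)); last by lra.
rewrite lerD// normrZ ler_pM//; first by rewrite ger0_norm.
by rewrite (le_trans (ler_normB _ _))// lerD.
Qed.

(** The fundamental theorem of calculus writes the increment as an integral of the coordinate's
    derivative, which the speed dominates up to time [T]; the rest of the curve only adds length. *)
Let length_ge_coord (M k : R) c (T : R) j :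
  0 < k -> (forall p v, `|p| <= M -> k * `|v| <= Num.sqrt (q p v)) ->
  C1_curve c -> 0 < T <= 1 -> (forall t, 0 <= t <= T -> `|c t| <= M) ->
  k * `|c T 0 j - c 0 0 j| <= riem_length Q c.
Proof.
move=> k0 kP Cc /andP[T0 T1] cM; have [dc cc] := Cc.
have cj t : derivable (fun t => c t 0 j) t 1.
  by have /derivable_mxP := dc t; exact.
have cj' t : derive1 (fun t => c t 0 j) t = derive1 c t 0 j.
  by rewrite !derive1E derive_mx// mxE.
have cj'_cont : continuous (fun t => derive1 c t 0 j).
  move=> t; apply: (@continuous_comp _ _ _ (derive1 c) (fun v : 'rV[R]_n => v 0 j)).
    exact: cc.
  exact: coord_continuous.
have cj_cont : continuous (fun t => c t 0 j).
  by move=> t; apply/differentiable_continuous/derivable1_diffP.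
have FTC : \int[lebesgue_measure]_(t in `[0, T]) (derive1 c t 0 j) = c T 0 j - c 0 0 j.
  rewrite /Rintegral (continuous_FTC2 (F := fun t => c t 0 j))//.
  - exact: continuous_subspaceT.
  - split; first by [].
      by apply/cvg_at_right_filter/cj_cont.
    by apply/cvg_at_left_filter/cj_cont.
rewrite -FTC -[k]gtr0_norm// -normrM -RintegralZl//; last exact: integrable_itv.
rewrite (le_trans (le_normr_Rintegral _ _))//.
  apply: integrable_itv => t; apply: cvgM; first exact: cvg_cst.
  exact: cj'_cont.
apply: (@le_trans _ _ (\int[lebesgue_measure]_(t in `[0, T]) speed c t)).
  apply: le_Rintegral => //.
  - apply: integrable_itv => t; apply: cvg_norm; apply: cvgM; first exact: cvg_cst.
    exact: cj'_cont.
  - exact/integrable_itv/speed_continuous.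
  move=> t /=; rewrite in_itv /= => tT.
  rewrite normrM gtr0_norm//; apply: le_trans (kP _ _ (cM t tT)).
  by rewrite ler_pM2l// coord_le_norm.
rewrite -subr_ge0 /riem_length Rintegral_itvB ?bnd_simp ?(ltW T0)//.
  by apply: Rintegral_ge0 => t _; exact: sqrtr_ge0.
exact/integrable_itv/speed_continuous.
Qed.

(* A curve leaving the unit ball around x already has length bounded below at
   the first time it is at distance 1 from x. *)
Lemma riem_dist_ge (M : R) : exists2 k : R, 0 < k &
  forall x y, `|x| <= M -> k * Num.min 1 `|x - y| <= riem_dist Q x y.
Proof.
have [k k0 kP] := metric_ge (M + 1); exists k => // x y xM.
apply: lb_le_inf; first by eexists; exact: curves_segment.
move=> _ [c [Cc c0 c1] <-].
have cont_c : continuous c.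
  by move=> u; apply/differentiable_continuous/derivable1_diffP; case: Cc.
pose f t := `|c t - x|.
have f_cont : continuous f.
  move=> t; apply: (@continuous_comp _ _ _ (fun t => c t - x) (fun v => `|v|)).
    by apply: cvgB; [exact: cont_c|exact: cvg_cst].
  exact: norm_continuous.
have f0 : f 0 = 0 by rewrite /f c0 subrr normr0.
have near_bound (T : R) : 0 <= T <= 1 -> (forall t, 0 <= t <= T -> f t <= 1) ->
    k * f T <= riem_length Q c.
  rewrite le_eqVlt => /andP[/predU1P[<-|T0] T1] fT.
    by rewrite f0 mulr0; apply: Rintegral_ge0 => t _; exact: sqrtr_ge0.
  rewrite mulrC -ler_pdivlMr//; apply: row_norm_le => [|j].
    by rewrite divr_ge0 ?(ltW k0)//; apply: Rintegral_ge0 => t _; exact: sqrtr_ge0.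
  rewrite ler_pdivlMr// mulrC !mxE -c0.
  apply: length_ge_coord k0 kP Cc _ _; first by rewrite T0.
  move=> t /fT ft; rewrite -[c t](subrK x) (le_trans (ler_normD _ _))// addrC.
  by rewrite lerD.
have hit t : 0 <= t -> 1 <= f t -> exists2 u, 0 <= u <= t & f u = 1.
  move=> t0 ft; have [||u] := @IVT R f 0 t 1 t0.
  - exact: continuous_subspaceT.
  - by rewrite f0 min_l ?max_r ?ler01 ?ft// (le_trans _ ft).
  by rewrite in_itv /= => ut fu; exists u.
(* The times at distance exactly 1 from [x]; compactness provides the first one. *)
pose D : set R := `[0, 1] `&` [set t | f t = 1].
have [D0|D0] := pselect (D !=set0).
  have cD : compact D.
    apply: (subclosed_compact _ (@segment_compact R 0 1)); last by move=> ? [].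
    apply: closedI; first exact: itv_closed.
    apply: (@preimage_closed _ _ f [set x | x = 1]); last exact: closed_eq.
    by move=> t _; exact: f_cont.
  have [T] := compact_EVT_min D0 cD (continuous_subspaceT (fun t => @cvg_id _ (nbhs t))).
  rewrite inE => -[/=]; rewrite in_itv /= => T01 fT Tmin.
  apply: (@le_trans _ _ (k * f T)); first by rewrite ler_pM2l// fT ge_min lexx.
  apply: near_bound => // t /andP[t0 tT]; rewrite leNgt; apply/negP => ft.
  (* If the curve were farther than 1 at a time [t <= T], it would have crossed distance 1 by then;
     minimality of [T] forces [u = t], a contradiction. *)
  have [u /andP[u0 ut] fu] := hit t t0 (ltW ft).
  have /andP[_ T1] := T01.
  have Tu : T <= u.
    by apply: Tmin; rewrite inE; split=> //=; rewrite in_itv /= u0 (le_trans ut)//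
      (le_trans tT).
  have tu : t = u by apply/eqP; rewrite eq_le ut (le_trans tT).
  by move: ft; rewrite tu fu ltxx.
apply: (@le_trans _ _ (k * f 1)).
  by rewrite ler_pM2l// /f c1 distrC ge_min lexx orbT.
apply: near_bound; first by rewrite ler01 lexx.
move=> t /andP[t0 t1]; rewrite leNgt; apply/negP => ft.
have [u /andP[u0 ut] fu] := hit t t0 (ltW ft).
by apply: D0; exists u; split=> //=; rewrite in_itv /= u0 (le_trans ut).
Qed.

End riemannian.

(** * The Riemannian quantity *)

Section riemannian_flatness.
Variables (R : realType) (n s : nat) (G : carnot R n s).
Variables (N : nat -> 'rV[R]_n -> R).
Hypothesis hN : forall i, (1 <= i <= s)%N -> homog_norm G i (N i).
Variable Q : 'rV[R]_n -> 'M[R]_n.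
Hypothesis hQ : left_inv_riem G Q.
Implicit Types (E L : set 'rV[R]_n) (x z : 'rV[R]_n) (r e : R).

Let Qcont i j : continuous (fun p => Q p i j).
Proof. by have [Qs _ _ _] := hQ; have := Qs i j 0%N. Qed.

Let Qpos p (v : 'rV[R]_n) : v != 0 -> 0 < (v *m Q p *m v^T) 0 0.
Proof. by have [_ _ + _] := hQ; exact. Qed.

Let rescale x r z := dil G r^-1 (cmul G (- x) z).

Let rescaleK x r z : 0 < r -> rescale x r (cmul G x (dil G r z)) = z.
Proof. by move=> r0; rewrite /rescale cmulVK dilVK// gt_eqF. Qed.

Let dilN (a : R) z : dil G a (- z) = - dil G a z.
Proof. by rewrite -[- z]scaleN1r dilZ scaleN1r. Qed.

(** The translation cancels in [a^-1 z], so flatness can be read off in the unit ball. *)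
Let rescale_diff x r a z : 0 < r ->
  cmul G (- rescale x r a) (rescale x r z) = dil G r^-1 (cmul G (- a) z).
Proof.
move=> r0; rewrite /rescale -dilN /dil -dilation_aut ?invr_gt0//.
by rewrite cmul_oppr opprK -cmulA cmulKV.
Qed.

Let rescaled E x r : set 'rV[R]_n :=
  (dil G r^-1 @` (cmul G (cinv G x) @` E)) `&` hball G N 0 1.

Let hballE x r z : 0 < r -> hball G N x r z <-> hball G N 0 1 (rescale x r z).
Proof.
move=> r0; rewrite /hball /hdist /qmul /= /cinv oppr0 cmul0l !cproj_top.
have [_ _ Ndil _ _] := homog_norm_top hN.
rewrite Ndil ?invr_gt0//; last exact: quot_top.
by rewrite mulrC ltr_pdivrMr// mul1r.
Qed.

Let rescaledP E x r z : 0 < r -> rescaled E x r z <->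
  exists2 y, (E `&` hball G N x r) y & z = rescale x r y.
Proof.
move=> r0; split=> [[[_ [y Ey <-] <-] /(hballE x y r0) xy]|[y [Ey xy] ->]].
  by exists y.
by split; [exists (cmul G (- x) y) => //; exists y|exact: (hballE x y r0).1].
Qed.

Let rescaled_bounded : exists2 M : R, 1 <= M &
  forall E x r z, rescaled E x r z -> `|z| <= M.
Proof.
have [M M1 MP] := unit_ball_bounded hN; exists M => // E x r z [_].
rewrite /hball /hdist /qmul /= /cinv oppr0 cmul0l !cproj_top => /ltW.
exact: MP.
Qed.

Let dist_riem_ge0 z L : 0 <= dist_set (riem_dist Q) z L.
Proof. by apply: dist_set_ge0 => a _; exact: riem_dist_ge0. Qed.

Let powR_root (e : R) : 0 <= e -> (e ^+ s) `^ s%:R^-1 = e.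
Proof.
move=> e0; rewrite -powR_mulrn// -powRrM mulfV ?powRr1//.
by rewrite pnatr_eq0 -lt0n (step_gt0 G).
Qed.

Lemma riem_flatness_le_flat (M : R) : exists2 K : R, 0 < K &
  forall E x r L e, 0 < r -> horiz_line G L -> 0 < e <= M ->
    flat G (E `&` hball G N x r) L r e ->
    (riem_flatness G N Q E x r <= (K * e)%:E)%E.
Proof.
have [B B1 BP] := rescaled_bounded.
have B0 : 0 <= B by exact: le_trans B1.
pose M2 := B + `|M| ^+ s.
have M20 : 0 <= M2 by rewrite addr_ge0// exprn_ge0.
have [K1 K10 K1P] := cmul_lipschitz G M2.
(* This radius contains both [z] and the nearby point of the rescaled line. *)
have [K2 K20 K2P] := riem_dist_le Qcont (B + K1 * `|M| ^+ s).
exists (1 + K2 * K1) => [|E x r L e r0 Lh /andP[e0 eM] Lf].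
  by rewrite addr_gt0// mulr_gt0.
have K0 : 0 <= 1 + K2 * K1 by rewrite addr_ge0// mulr_ge0 ?ltW.
apply: ge_ereal_inf; eexists.
  exists (rescale x r @` L); last by reflexivity.
  by apply: horiz_line_dil Lh; rewrite invr_gt0.
apply: esup_on_le => [|z zF]; first by rewrite mulr_ge0 ?(ltW e0).
have [y Sy zE] := (rescaledP _ _ _ r0).1 zF.
have [a La ay] := Lf y Sy.
pose b := dil G r^-1 (cmul G (- a) y).
(* Writing the point of the line as [z . b^-1] lets the Lipschitz bound on the group law turn the
   smallness of [b] into closeness to [z . 0]. *)
have aE : rescale x r a = cmul G z (- b).
  rewrite zE /b -(rescale_diff x a y r0) cmul_oppr opprK cmulA cmulgV.
  by rewrite cmul0l.
have eMs : e ^+ s <= `|M| ^+ s.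
  by rewrite lerXn2r ?nnegrE ?(ltW e0)// (le_trans eM)// ler_norm.
have zB := BP _ _ _ _ zF.
have za : `|z - rescale x r a| <= K1 * e ^+ s.
  have := K1P z 0 z (- b); rewrite cmul0r aE subrr normr0 add0r sub0r opprK normrN.
  have zM2 : `|z| <= M2 by rewrite (le_trans zB)// lerDl exprn_ge0.
  have bM2 : `|b| <= M2 by rewrite (le_trans ay)// (le_trans eMs)// lerDr.
  move=> /(_ zM2 M20 zM2 bM2) /le_trans; apply.
  by rewrite ler_pM2l.
have dz : dist_set (riem_dist Q) z (rescale x r @` L) <= ((1 + K2 * K1) * e) ^+ s.
  apply: (@le_trans _ _ (riem_dist Q z (rescale x r a))).
    by apply: dist_set_le => [? _|]; [exact: riem_dist_ge0|exists a].
  apply: (@le_trans _ _ (K2 * `|z - rescale x r a|)).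
    apply: K2P; first by rewrite (le_trans zB)// lerDl mulr_ge0 ?exprn_ge0 ?(ltW K10).
    rewrite -[rescale x r a](subKr z) (le_trans (ler_normB _ _))// lerD//.
    by rewrite (le_trans za)// ler_pM2l.
  apply: (@le_trans _ _ (K2 * (K1 * e ^+ s))); first by rewrite ler_pM2l.
  rewrite mulrA exprMn ler_wpM2r ?exprn_ge0 ?(ltW e0)//.
  rewrite (@le_trans _ _ (1 + K2 * K1)) ?lerDr// ler_eXnr ?(step_gt0 G)//.
  by rewrite lerDl mulr_ge0 ?ltW.
rewrite -[leRHS]powR_root ?mulr_ge0 ?(ltW e0)//.
by rewrite ge0_ler_powR ?nnegrE ?invr_ge0 ?dist_riem_ge0// exprn_ge0// mulr_ge0 ?(ltW e0).
Qed.

Lemma flat_of_riem_flatness_lt : exists e0, exists K : R, [/\ 0 < e0, 0 < K &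
  forall E x r e, 0 < r -> 0 < e < e0 -> (riem_flatness G N Q E x r < e%:E)%E ->
    exists2 L, horiz_line G L & flat G (E `&` hball G N x r) L r (K * e)].
Proof.
have [B B1 BP] := rescaled_bounded.
have B0 : 0 <= B by exact: le_trans B1.
have [K1 K10 K1P] := cmul_lipschitz G (B + 1).
have [k k0 kP] := riem_dist_ge Qcont Qpos B.
have Kk : 0 < K1 / k by exact: divr_gt0.
(* For [e] below 1 and [k] one has [e ^+ s <= e < k], which rules out the truncated value 1 in
   [riem_dist_ge]. *)
exists (Num.min 1 k), (1 + K1 / k); split.
- by rewrite lt_min ltr01.
- by rewrite addr_gt0.
move=> E x r e r0 /andP[e0]; rewrite lt_min => /andP[e1 ek].
move=> /ereal_inf_lt[_ [L Lh <-] Le].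
(* This is the line [x . dil G r L], written in the form that [horiz_line_dil] accepts. *)
exists ((fun y => dil G r (cmul G (dil G r^-1 x) y)) @` L).
  exact: horiz_line_dil.
move=> y Sy; pose z := rescale x r y.
have zF : rescaled E x r z by apply/rescaledP => //; exists y.
have dz : dist_set (riem_dist Q) z L < e ^+ s.
  rewrite ltNge; apply/negP => ez.
  have := le_lt_trans
    (esup_on_ge (fun z => dist_set (riem_dist Q) z L `^ s%:R^-1) zF) Le.
  rewrite lte_fin ltNge -[in X in ~~ X](powR_root (ltW e0)) => /negP; apply.
  by rewrite ge0_ler_powR ?nnegrE ?invr_ge0 ?dist_riem_ge0// exprn_ge0// ltW.
have L0 : L !=set0.
  have [g [v [_ _ ->]]] := Lh; exists (cmul G g (0 *: v)) => /=; by exists 0.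
have [a La za] := dist_set_lt L0 dz.
exists (dil G r (cmul G (dil G r^-1 x) a)); first by exists a.
have -> : dil G r (cmul G (dil G r^-1 x) a) = cmul G x (dil G r a).
  by rewrite /dil dilation_aut// -!/(dil G _ _) dilK// gt_eqF.
rewrite -(rescale_diff x _ _ r0) rescaleK// -/z.
have zB := BP _ _ _ _ zF.
have ese : e ^+ s <= e by rewrite ler_iXnr ?(step_gt0 G)// ltW.
have za' : `|z - a| <= e ^+ s / k.
  have := le_lt_trans (kP z a zB) za.
  rewrite mulrC -ltr_pdivlMr// gt_min => /orP[|/ltW//].
  rewrite ltr_pdivlMr// mul1r => kes.
  by have := lt_trans ek (lt_le_trans kes ese); rewrite ltxx.
have aB : `|a| <= B + 1.
  rewrite -[a](subKr z) (le_trans (ler_normB _ _))// lerD//.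
  by rewrite (le_trans za')// ler_pdivrMr// mul1r (le_trans ese)// ltW.
have zB' : `|z| <= B + 1 by rewrite (le_trans zB)// lerDl.
(* Comparing [a^-1 z] with [a^-1 a = 0] bounds it by a multiple of [|z - a|]. *)
have := K1P (- a) z (- a) a; rewrite cmulVg subr0 subrr normr0 add0r normrN.
move=> /(_ aB zB' aB aB) /le_trans; apply.
rewrite exprMn; apply: (@le_trans _ _ (K1 / k * e ^+ s)).
  by rewrite -mulrA ler_pM2l// mulrC.
rewrite ler_wpM2r ?exprn_ge0 ?(ltW e0)//.
rewrite (@le_trans _ _ (1 + K1 / k)) ?lerDr// ler_eXnr ?(step_gt0 G)//.
by rewrite lerDl ltW.
Qed.

Lemma riem_flatness_measures : exists2 K : R, 0 < K &
  measures_flatness G N (riem_flatness G N Q) K.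
Proof.
apply: measures_flatness_intro hN _ _ riem_flatness_le_flat flat_of_riem_flatness_lt.
by move=> E x r; apply: le_ereal_inf_tmp => _ [L _ <-]; exact: esup_on_ge0.
Qed.

End riemannian_flatness.

(** * Pairwise comparison of the three quantities *)

Theorem proposition1p6 (R : realType) (n s : nat) (G : carnot R n s)
  (N : nat -> 'rV[R]_n -> R)
  (hN : forall i, (1 <= i <= s)%N -> homog_norm G i (N i))
  (Q : 'rV[R]_n -> 'M[R]_n) (hQ : left_inv_riem G Q)
  (c : R) (hc : 0 < c) :
  exists C : R, 0 < C /\
    forall (E : set 'rV[R]_n) (x : 'rV[R]_n) (r : R), 0 < r ->
      [/\ comparable_upto C (strat_beta G N E x r) (euc_flatness G N c E x r),
          comparable_upto C (strat_beta G N E x r) (riem_flatness G N Q E x r)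
        & comparable_upto C (euc_flatness G N c E x r)
                            (riem_flatness G N Q E x r)].
Proof.
have [K1 K10 K1P] := strat_beta_measures hN.
have [K2 K20 K2P] := euc_flatness_measures hN hc.
have [K3 K30 K3P] := riem_flatness_measures hN hQ.
have K0 : 0 < K1 * K2 + K1 * K3 + K2 * K3 by rewrite !addr_gt0// mulr_gt0.
(* Each comparison costs the product of two of the constants; the sum dominates all three
   products. *)
exists (K1 * K2 + K1 * K3 + K2 * K3); split=> // E x r r0.
have le_C (a b : \bar R) (K : R) : (0 <= b)%E -> K <= K1 * K2 + K1 * K3 + K2 * K3 ->
    (a <= K%:E * b)%E -> (a <= (K1 * K2 + K1 * K3 + K2 * K3)%:E * b)%E.
  by move=> b0 KC /le_trans; apply; rewrite lee_wpmul2r// lee_fin.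
have [X0 _ _] := K1P E x r r0.
have [Y0 _ _] := K2P E x r r0.
have [Z0 _ _] := K3P E x r r0.
have p12 := mulr_gt0 K10 K20; have p13 := mulr_gt0 K10 K30.
have p23 := mulr_gt0 K20 K30.
split; split.
- apply: le_C (measures_flatness_le K10 K20 K1P K2P E x r0) => //; lra.
- apply: le_C (measures_flatness_le K20 K10 K2P K1P E x r0) => //; lra.
- apply: le_C (measures_flatness_le K10 K30 K1P K3P E x r0) => //; lra.
- apply: le_C (measures_flatness_le K30 K10 K3P K1P E x r0) => //; lra.
- apply: le_C (measures_flatness_le K20 K30 K2P K3P E x r0) => //; lra.
- apply: le_C (measures_flatness_le K30 K20 K3P K2P E x r0) => //; lra.
Qed.
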